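(* The mixed integer program BRP-m3 can be simplified without sacrificing its correctness by the following three modifications: (a) relax the integer variables $x_{ij}^t$ and $u_i^t$ to continuous ones ($x_{ij}^t\in[0,1]$, $u_i^t\in[1,H]$); (b) eliminate the constraints ($\hat{\mathrm y}$3), (z1) and (z2); (c) add the equalities - (e1) $z_{1i}^t=\hat y_{j1}^t$ for the $i\in\mathbb{B}'$ with $C_{1i}=1$, the $j\in\mathbb{B}$ with $C_{j1}=1$, and all $t\in\mathbb{T}$; - (e2) $\sum_{t\in\mathbb{T}}\hat y_{i1}^t=1$ for the $i\in\mathbb{B}$ with $C_{i1}=1$; - (e3) $\check y_{i1}^t=0$ for $i\in\mathbb{B}\setminus\{1\}$, $t\in\mathbb{T}$; - (e4) $x_{i1}^t=\hat y_{i1}^t=0$ for $i\in\mathbb{B}\setminus\{1\}$ with $C_{i1}=0$, $t\in\mathbb{T}$; - (e5) $\hat y_{1i}^t=\check y_{1i}^t=0$ for $i\in\mathbb{B}'\setminus\{1\}$, $t\in\mathbb{T}$; - (e6) $x_{1i}^t=z_{1i}^t=0$ for $i\in\mathbb{B}'\setminus\{1\}$ with $C_{1i}=0$, $t\in\mathbb{T}$; - (e7) $u_1^t=h_1$ for $t\in\mathbb{T}$. That is, the modified model is still an exact formulation of the block relocation problem: its optimal value equals that of BRP-m3 (the minimum number of relocations), and its optimal solutions encode optimal move sequences.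
   Context: Block relocation problem (BRP). Blocks $\mathbb{B}=\{1,\dots,B\}$ (smaller label = higher priority) are piled on $S$ stacks with height limit $H$ (at most $H$ blocks per stack). A relocation moves the topmost block of a stack onto a different stack (respecting the height limit). A retrieval removes the block of smallest remaining label, allowed only when it is topmost. The goal is to retrieve all blocks with the minimum number of relocations. No block is directly retrievable in the initial configuration (block $1$ is not topmost), and the instance is feasible. Notation. $\mathbb{B}'=\mathbb{B}\cup\{B+1\}$, where $B+1$ is a virtual block representing the floor of all stacks. $C_{ij}=1$ if initially block $i$ lies directly upon block $j$ (or on the floor if $j=B+1$), else $0$. $h_i$ is the height (tier number, bottom $=1$) of block $i$ in the initial configuration. $L$ is a lower bound and $T$ an upper bound on the minimum number of relocations, and $\mathbb{T}=\{1,\dots,T\}$. Turn $t$ consists of the $t$-th relocation and all subsequent retrievals before the next relocation; $0$ denotes the initial stage. Variables: $x_{ij}^t$ ($i\in\mathbb{B}$, $j\in\mathbb{B}'\setminus\{i\}$, $t\in\mathbb{T}\cup\{0\}$): $1$ iff block $i$ is directly upon $j$ at the end of turn $t$. $\hat y_{ij}^t$ (resp. $\check y_{ij}^t$) ($i\in\mathbb{B}$, $j\in\mathbb{B}'\setminus\{i\}$, $t\in\mathbb{T}$): $1$ iff in turn $t$ block $i$ is lifted up from directly upon $j$ (resp. put down directly upon $j$). $z_{ij}^t$ ($i\in\mathbb{B}$, $j\in\mathbb{B}'$, $j>i$, $t\in\mathbb{T}$): $1$ iff block $i$ is retrieved from the top of $j$ in turn $t$. $u_i^t$ ($i\in\mathbb{B}$,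 $t\in\mathbb{T}$): height of block $i$ just after the put-down in turn $t$. BRP-m3: minimize $\sum_{i\in\mathbb{B}}\sum_{j\in\mathbb{B}'\setminus\{i\}}\sum_{t\in\mathbb{T}}\check y_{ij}^t$ subject to (x1) $x_{ij}^0=C_{ij}$ for $i\in\mathbb{B}$, $j\in\mathbb{B}'\setminus\{i\}$; (x2) $x_{ij}^t=x_{ij}^{t-1}-\hat y_{ij}^t+\check y_{ij}^t$ for $i\in\mathbb{B}$, $j\in\mathbb{B}'$, $j<i$, $t\in\mathbb{T}$; (x3) $x_{ij}^t=x_{ij}^{t-1}-\hat y_{ij}^t+\check y_{ij}^t-z_{ij}^t$ for $i\in\mathbb{B}$, $j\in\mathbb{B}'$, $j>i$, $t\in\mathbb{T}$; (x4) $x_{ij}^T=0$ for $i\in\mathbb{B}$, $j\in\mathbb{B}'\setminus\{i\}$; (x5) $x_{ij}^t\in\{0,1\}$; ($\hat{\mathrm y}$1) $\sum_{i\in\mathbb{B}}\sum_{j\in\mathbb{B}'\setminus\{i\}}\hat y_{ij}^t=1$ for $t\in\mathbb{T}$, $t\le L$; ($\hat{\mathrm y}$2) $\sum_{i\in\mathbb{B}}\sum_{j\in\mathbb{B}'\setminus\{i\}}\hat y_{ij}^t\le\sum_{i\in\mathbb{B}}\sum_{j\in\mathbb{B}'\setminus\{i\}}\hat y_{ij}^{t-1}$ for $t\in\mathbb{T}$, $t>L$; ($\hat{\mathrm y}$3) $\hat y_{ij}^t\le x_{ij}^{t-1}$ for $i\in\mathbb{B}$, $j\in\mathbb{B}'\setminus\{i\}$,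 $t\in\mathbb{T}$; ($\hat{\mathrm y}$4) $\sum_{j\in\mathbb{B}'\setminus\{i\}}\hat y_{ij}^t\le\sum_{j\in\mathbb{B}'\setminus\{i\}}x_{ij}^{t-1}-\sum_{j\in\mathbb{B}\setminus\{i\}}x_{ji}^{t-1}$ for $i\in\mathbb{B}$, $t\in\mathbb{T}$; ($\hat{\mathrm y}$5) $\hat y_{ij}^t\in\{0,1\}$; ($\check{\mathrm y}$1) $\sum_{j\in\mathbb{B}'\setminus\{i\}}\check y_{ij}^t=\sum_{j\in\mathbb{B}'\setminus\{i\}}\hat y_{ij}^t$ for $i\in\mathbb{B}$, $t\in\mathbb{T}$; ($\check{\mathrm y}$2) $\sum_{j\in\mathbb{B}\setminus\{i\}}\check y_{ji}^t\le\sum_{j\in\mathbb{B}'\setminus\{i\}}x_{ij}^{t-1}-\sum_{j\in\mathbb{B}\setminus\{i\}}\hat y_{ji}^t$ for $i\in\mathbb{B}$, $t\in\mathbb{T}$; ($\check{\mathrm y}$3) $\sum_{j\in\mathbb{B}}\check y_{j(B+1)}^t\le 1-\sum_{j\in\mathbb{B}}\hat y_{j(B+1)}^t$ for $t\in\mathbb{T}$; ($\check{\mathrm y}$4) $\sum_{j\in\mathbb{B}\setminus\{i\}}\check y_{ji}^t\le\sum_{j\in\mathbb{B}'\setminus\{i\}}x_{ij}^{t-1}-\sum_{j\in\mathbb{B}\setminus\{i\}}x_{ji}^{t-1}$ for $i\in\mathbb{B}$, $t\in\mathbb{T}$; ($\check{\mathrm y}$5) $\sum_{j\in\mathbb{B}}\check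 y_{j(B+1)}^t\le S-\sum_{j\in\mathbb{B}}x_{j(B+1)}^{t-1}$ for $t\in\mathbb{T}$; ($\check{\mathrm y}$6) $\check y_{ij}^t\in\{0,1\}$; (z1) $z_{ij}^t\le x_{ij}^{t-1}-\hat y_{ij}^t+\check y_{ij}^t$ for $i\in\mathbb{B}$, $j\in\mathbb{B}'$, $j>i$, $t\in\mathbb{T}$; (z2) $\sum_{j\in\mathbb{B}',j>i}z_{ij}^t\le\sum_{j\in\mathbb{B}'\setminus\{i\}}x_{ij}^{t-1}-\sum_{j\in\mathbb{B},j>i}(x_{ji}^{t-1}-\hat y_{ji}^t+\check y_{ji}^t)$ for $i\in\mathbb{B}$, $t\in\mathbb{T}$; (z3) $\sum_{j\in\mathbb{B}',j>i}\sum_{\tau\in\mathbb{T},\tau\le t}z_{ij}^\tau\le\sum_{j\in\mathbb{B}',j>i-1}\sum_{\tau\in\mathbb{T},\tau\le t}z_{(i-1)j}^\tau$ for $i\in\mathbb{B}\setminus\{1\}$, $t\in\mathbb{T}$; (z4) $z_{ij}^t\in\{0,1\}$; (u1) $u_i^t\ge u_j^t+1-H(1-x_{ij}^{t-1}+\hat y_{ij}^t-\check y_{ij}^t)$ for $i\in\mathbb{B}$, $j\in\mathbb{B}\setminus\{i\}$, $t\in\mathbb{T}$; (u2) $u_i^t\in\{1,\dots,H\}$ for $i\in\mathbb{B}$, $t\in\mathbb{T}$. *)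

(* Defs.v *)
From HB Require Import structures.
From mathcomp Require Import all_boot all_order all_algebra.

Set Implicit Arguments.
Unset Strict Implicit.
Unset Printing Implicit Defensive.

Import Order.TTheory GRing.Theory Num.Theory.
Local Open Scope ring_scope.

(* Each stack lists its blocks from top to bottom. *)
Definition config (S : nat) := {ffun 'I_S -> seq nat}.

Inductive move (S : nat) :=
  | Reloc of 'I_S & 'I_S   (* source, destination *)
  | Retr of 'I_S.

Section Moves.
Variable S : nat.
Implicit Types (c : config S) (mv : move S) (ms : seq (move S)).

Definition is_reloc mv : bool := if mv is Reloc _ _ then true else false.

Definition nreloc ms : nat := count is_reloc ms.

Definition legal (H : nat) c mv : bool :=
  match mv with
  | Reloc s d => [&& s != d, c s != [::] & (size (c d) < H)%N]
  | Retr s => if c s is b :: _ then [forall k, all (leq b) (c k)] else false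
  end.

Definition next c mv : config S :=
  match mv with
  | Reloc s d => [ffun k => if k == s then behead (c s)
                            else if k == d then take 1 (c s) ++ c d
                            else c k]
  | Retr s => [ffun k => if k == s then behead (c s) else c k]
  end.

Definition exec c ms : config S := foldl next c ms.

Fixpoint legal_seq (H : nat) c ms : bool :=
  if ms is mv :: ms' then legal H c mv && legal_seq H (next c mv) ms' else true.

Definition solves (H : nat) c ms : bool :=
  legal_seq H c ms && (exec c ms == [ffun=> [::]]).

Definition min_relocations (H : nat) c (m : nat) : Prop :=
  (exists ms, solves H c ms /\ nreloc ms = m) /\
  (forall ms, solves H c ms -> (m <= nreloc ms)%N).

Definition valid_config (B H : nat) c : Prop :=
  perm_eq (flatten [seq c s | s <- enum 'I_S]) (iota 1 B) /\
  (forall s, (size (c s) <= H)%N).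

Definition block1_not_topmost c : Prop := forall s, ohead (c s) != Some 1%N.

(* The floor is the virtual block B.+1, appended below every stack. *)
Definition with_floor (B : nat) (st : seq nat) : seq nat := rcons st B.+1.

Definition lies_on (B : nat) c (i j : nat) : bool :=
  [exists s, infix [:: i; j] (with_floor B (c s))].

Definition height c (i : nat) : nat :=
  (\sum_(s : 'I_S | i \in c s) (size (c s) - index i (c s)))%N.

(* In configuration c, the move mv lifts block i from j, puts block i down on j,
   or retrieves block i from the top of j. *)
Definition lifts (B i j : nat) c mv : bool :=
  if mv is Reloc s _ then prefix [:: i; j] (with_floor B (c s)) else false.

Definition puts (B i j : nat) c mv : bool :=
  if mv is Reloc s d then
    (ohead (c s) == Some i) && (ohead (with_floor B (c d)) == Some j)
  else false.

Definition retrieves (B i j : nat) c mv : bool :=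
  if mv is Retr s then prefix [:: i; j] (with_floor B (c s)) else false.

Fixpoint occurs (ev : config S -> move S -> bool) c ms : bool :=
  if ms is mv :: ms' then ev c mv || occurs ev (next c mv) ms' else false.

End Moves.

Record solution (R : Type) := Solution {
  vx : nat -> nat -> nat -> R;   (* vx i j t is x_ij^t; likewise below *)
  yhat : nat -> nat -> nat -> R;
  ycheck : nat -> nat -> nat -> R;
  vz : nat -> nat -> nat -> R;
  vu : nat -> nat -> R
}.

(* Variables are total functions on nat; the model only constrains, and the
   objective only reads, the entries whose indices are in range. *)
Section Model.
Variables (R : realFieldType) (B S H L T : nat) (c0 : config S).
Implicit Types (v : solution R) (i j t : nat).

Definition inB i : bool := (1 <= i <= B)%N.
Definition inB' j : bool := (1 <= j <= B.+1)%N.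
Definition inT t : bool := (1 <= t <= T)%N.

Definition binary (a : R) : Prop := a = 0 \/ a = 1.

Definition initC i j : R := (lies_on B c0 i j)%:R.

Definition objective v : R :=
  \sum_(1 <= i < B.+1) \sum_(1 <= j < B.+2 | j != i) \sum_(1 <= t < T.+1)
    ycheck v i j t.

Record common v : Prop := Common {
  cons_x1 : forall i j, inB i -> inB' j -> j != i -> vx v i j 0 = initC i j;
  cons_x2 : forall i j t, inB i -> inB' j -> (j < i)%N -> inT t ->
    vx v i j t = vx v i j t.-1 - yhat v i j t + ycheck v i j t;
  cons_x3 : forall i j t, inB i -> inB' j -> (i < j)%N -> inT t ->
    vx v i j t = vx v i j t.-1 - yhat v i j t + ycheck v i j t - vz v i j t;
  cons_x4 : forall i j, inB i -> inB' j -> j != i -> vx v i j T = 0;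

  cons_yhat1 : forall t, inT t -> (t <= L)%N ->
    \sum_(1 <= i < B.+1) \sum_(1 <= j < B.+2 | j != i) yhat v i j t = 1;
  cons_yhat2 : forall t, inT t -> (L < t)%N ->
    \sum_(1 <= i < B.+1) \sum_(1 <= j < B.+2 | j != i) yhat v i j t <=
    \sum_(1 <= i < B.+1) \sum_(1 <= j < B.+2 | j != i) yhat v i j t.-1;
  cons_yhat4 : forall i t, inB i -> inT t ->
    \sum_(1 <= j < B.+2 | j != i) yhat v i j t <=
    \sum_(1 <= j < B.+2 | j != i) vx v i j t.-1
      - \sum_(1 <= j < B.+1 | j != i) vx v j i t.-1;
  cons_yhat5 : forall i j t, inB i -> inB' j -> j != i -> inT t ->
    binary (yhat v i j t);

  cons_ycheck1 : forall i t, inB i -> inT t ->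
    \sum_(1 <= j < B.+2 | j != i) ycheck v i j t =
    \sum_(1 <= j < B.+2 | j != i) yhat v i j t;
  cons_ycheck2 : forall i t, inB i -> inT t ->
    \sum_(1 <= j < B.+1 | j != i) ycheck v j i t <=
    \sum_(1 <= j < B.+2 | j != i) vx v i j t.-1
      - \sum_(1 <= j < B.+1 | j != i) yhat v j i t;
  cons_ycheck3 : forall t, inT t ->
    \sum_(1 <= j < B.+1) ycheck v j B.+1 t <=
    1 - \sum_(1 <= j < B.+1) yhat v j B.+1 t;
  cons_ycheck4 : forall i t, inB i -> inT t ->
    \sum_(1 <= j < B.+1 | j != i) ycheck v j i t <=
    \sum_(1 <= j < B.+2 | j != i) vx v i j t.-1
      - \sum_(1 <= j < B.+1 | j != i) vx v j i t.-1;
  cons_ycheck5 : forall t, inT t ->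
    \sum_(1 <= j < B.+1) ycheck v j B.+1 t <=
    S%:R - \sum_(1 <= j < B.+1) vx v j B.+1 t.-1;
  cons_ycheck6 : forall i j t, inB i -> inB' j -> j != i -> inT t ->
    binary (ycheck v i j t);

  cons_z3 : forall i t, inB i -> i != 1%N -> inT t ->
    \sum_(1 <= j < B.+2 | (i < j)%N) \sum_(1 <= tau < t.+1) vz v i j tau <=
    \sum_(1 <= j < B.+2 | (i.-1 < j)%N) \sum_(1 <= tau < t.+1) vz v i.-1 j tau;
  cons_z4 : forall i j t, inB i -> inB' j -> (i < j)%N -> inT t ->
    binary (vz v i j t);

  cons_u1 : forall i j t, inB i -> inB j -> j != i -> inT t ->
    vu v i t >= vu v j t + 1
      - H%:R * (1 - vx v i j t.-1 + yhat v i j t - ycheck v i j t)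
}.

Record brp_m3 v : Prop := BrpM3 {
  m3_common : common v;
  cons_x5 : forall i j t, inB i -> inB' j -> j != i -> (t <= T)%N ->
    binary (vx v i j t);
  cons_yhat3 : forall i j t, inB i -> inB' j -> j != i -> inT t ->
    yhat v i j t <= vx v i j t.-1;
  cons_z1 : forall i j t, inB i -> inB' j -> (i < j)%N -> inT t ->
    vz v i j t <= vx v i j t.-1 - yhat v i j t + ycheck v i j t;
  cons_z2 : forall i t, inB i -> inT t ->
    \sum_(1 <= j < B.+2 | (i < j)%N) vz v i j t <=
    \sum_(1 <= j < B.+2 | j != i) vx v i j t.-1
      - \sum_(1 <= j < B.+1 | (i < j)%N)
          (vx v j i t.-1 - yhat v j i t + ycheck v j i t);
  cons_u2 : forall i t, inB i -> inT t ->
    exists k : nat, (1 <= k <= H)%N /\ vu v i t = k%:R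
}.

Record brp_m3_simplified v : Prop := BrpM3Simplified {
  simplified_common : common v;
  cons_x5_relaxed : forall i j t, inB i -> inB' j -> j != i -> (t <= T)%N ->
    0 <= vx v i j t <= 1;
  cons_u2_relaxed : forall i t, inB i -> inT t -> 1 <= vu v i t <= H%:R;
  cons_e1 : forall i j t, inB' i -> lies_on B c0 1 i ->
    inB j -> lies_on B c0 j 1 -> inT t -> vz v 1 i t = yhat v j 1 t;
  cons_e2 : forall i, inB i -> lies_on B c0 i 1 ->
    \sum_(1 <= t < T.+1) yhat v i 1 t = 1;
  cons_e3 : forall i t, inB i -> i != 1%N -> inT t -> ycheck v i 1 t = 0;
  cons_e4 : forall i t, inB i -> i != 1%N -> ~~ lies_on B c0 i 1 -> inT t ->
    vx v i 1 t = 0 /\ yhat v i 1 t = 0;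
  cons_e5 : forall i t, inB' i -> i != 1%N -> inT t ->
    yhat v 1 i t = 0 /\ ycheck v 1 i t = 0;
  cons_e6 : forall i t, inB' i -> i != 1%N -> ~~ lies_on B c0 1 i -> inT t ->
    vx v 1 i t = 0 /\ vz v 1 i t = 0;
  cons_e7 : forall t, inT t -> vu v 1 t = (height c0 1)%:R
}.

Definition optimal (feasible : solution R -> Prop) v : Prop :=
  feasible v /\ forall w, feasible w -> objective v <= objective w.

Definition optimal_value (feasible : solution R -> Prop) (a : R) : Prop :=
  exists v, optimal feasible v /\ objective v = a.

(* trs lists turns 1 to T of the move sequence ms.  Turn t starts with the t-th
   relocation if there is one; since the models allow T to exceed the number of
   relocations and do not force a retrievable block to be retrieved at once, the
   last retrievals may be spread over later turns, which have no relocation. *)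
Definition turns_of (ms : seq (move S)) (trs : seq (seq (move S))) : Prop :=
  [/\ size trs = T, flatten trs = ms &
      forall t, inT t -> exists n,
        map (@is_reloc S) (nth [::] trs t.-1) =
        nseq (t <= nreloc ms)%N true ++ nseq n false].

(* The variables u_i^t are not part of the encoding: even in BRP-m3 they are only
   bounded below by the heights, and are arbitrary for retrieved blocks. *)
Definition encodes v (ms : seq (move S)) : Prop :=
  exists trs, turns_of ms trs /\
    let stage t := exec c0 (flatten (take t trs)) in
    let turn t := nth [::] trs t.-1 in
    [/\ forall i j t, inB i -> inB' j -> j != i -> (t <= T)%N ->
          vx v i j t = (lies_on B (stage t) i j)%:R,
        forall i j t, inB i -> inB' j -> j != i -> inT t ->
          yhat v i j t = (occurs (lifts B i j) (stage t.-1) (turn t))%:R,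
        forall i j t, inB i -> inB' j -> j != i -> inT t ->
          ycheck v i j t = (occurs (puts B i j) (stage t.-1) (turn t))%:R &
        forall i j t, inB i -> inB' j -> (i < j)%N -> inT t ->
          vz v i j t = (occurs (retrieves B i j) (stage t.-1) (turn t))%:R].

End Model.

(* Main.v *)
From mathcomp Require Import all_boot all_order all_algebra fingroup perm.
From mathcomp Require Import zify lra.
Require Import Defs.

Set Implicit Arguments.
Unset Strict Implicit.
Unset Printing Implicit Defensive.

Import Order.TTheory GRing.Theory Num.Theory.
Local Open Scope ring_scope.

(** Writing x^t for the incidence matrix of a configuration (x_ij = 1 iff i lies directly on j),
    a relocation or a retrieval changes it by the terms of the balance equations (x2) and (x3).

    From solutions to moves: only the constraints shared by both models and the bounds on x and u
    are needed.  Inductively x^(t-1) is the matrix of an actual configuration.  A lift of i from j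
    with x_ij^(t-1) = 0 would, as x_ij^t >= 0, be a put-down on the same j, which (ycheck2) and
    (ycheck3) forbid; hence the lift is genuine, and so is the put-down.  A block left on top of
    a retrieved block i would make the right-hand side of (yhat4) for i negative in the next turn
    (or contradict (x4)), so the retrievals of a turn can be carried out in the order of labels.
    The values of u increase along a stack, which gives the height limit.

    From moves to solutions: erasing any block from a configuration never increases the number of
    relocations, so some optimal sequence retrieves block 1 as soon as it is uncovered.  By
    optimality it never moves a lone block to an empty stack, and its encoding satisfies BRP-m3.
    In it the row and the column of block 1 in x^t are constant until they vanish simultaneously,
    and (e1)-(e6) are then consequences of the BRP-m3 constraints. *)

(** * Configurations and incidence matrices *)

Section Indicators.
Variable R : realFieldType.

Lemma sum_nat_pred1 (m n k : nat) (P : pred nat) :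
  \sum_(m <= j < n | P j) (j == k)%:R = [&& (m <= k)%N, (k < n)%N & P k]%:R :> R.
Proof.
rewrite (eq_bigr (fun j => if j == k then 1 else 0)); last by move=> j _; case: eqP.
rewrite -big_mkcondr big_const_seq iter_addr_0; congr (_%:R).
rewrite (eq_count (a2 := fun j => (j == k) && P k)); last first.
  by move=> j /=; case: eqP => [->|]; rewrite ?andbT ?andbF.
case: (P k); last by rewrite !andbF; elim: (index_iota m n) => //= x s ->; rewrite andbF.
rewrite (eq_count (a2 := pred1 k)) => [|j /=]; last by rewrite andbT.
by rewrite count_uniq_mem ?iota_uniq // mem_index_iota andbT.
Qed.

(** Uniqueness of the witness makes the indicator additive; as a block occurs in at most one stack,
    configuration-wide indicators become sums over the stacks. *)
Lemma natr_exists (I : finType) (P : pred I) :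
  (forall s s', P s -> P s' -> s = s') -> [exists s, P s]%:R = \sum_s (P s)%:R :> R.
Proof.
move=> uP; case: existsP => [[s Ps]|nP].
  rewrite (bigD1 s) //= Ps big1 ?addr0 // => k /negP ks.
  by case: (boolP (P k)) => // Pk; case: ks; apply/eqP/uP.
by rewrite big1 // => k _; case: (boolP (P k)) => // Pk; case: nP; exists k.
Qed.

Lemma natr_orb (b c : bool) : ~~ (b && c) -> (b || c)%:R = b%:R + c%:R :> R.
Proof. by case: b; case: c => //=; rewrite ?addr0 ?add0r. Qed.

Lemma natr_bool_inj (b c : bool) : b%:R = c%:R :> R -> b = c.
Proof. by case: b; case: c => //= /eqP; rewrite ?oner_eq0 // eq_sym oner_eq0. Qed.

End Indicators.

(** * Adjacency within one stack: row, column and floor sums *)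

Section Adjacency.
Variables (R : realFieldType) (B : nat).
Implicit Types (st : seq nat) (i j : nat).

(** What a block put on top of [st] would rest on: the top block of [st], or the floor [B.+1] if
    [st] is empty. *)
Definition below st : nat := head B.+1 st.

(** Recursive form of the [infix] test in [lies_on], suited to induction on the stack. *)
Fixpoint adj st i j : bool :=
  if st is a :: st' then (i == a) && (j == below st') || adj st' i j else false.

Lemma prefix_below st a i j :
  prefix [:: i; j] (with_floor B (a :: st)) = (i == a) && (j == below st).
Proof. by rewrite /with_floor /= ; case: st => [|b st] /=; rewrite ?prefix0s ?andbT. Qed.

Lemma infix_adj st i j : infix [:: i; j] (with_floor B st) = adj st i j.
Proof.
elim: st => [|a st IH] /=; first by rewrite /with_floor /= andbF.
by rewrite -IH /= -prefix_below -infix_consl.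
Qed.

Lemma adj_mem st i j : adj st i j -> i \in st.
Proof.
elim: st => //= a st IH /orP[/andP[/eqP-> _]|/IH]; first by rewrite mem_head.
by rewrite inE orbC => ->.
Qed.

Lemma natr_adj_cons a st i j : a \notin st ->
  (adj (a :: st) i j)%:R = ((i == a) && (j == below st))%:R + (adj st i j)%:R :> R.
Proof.
move=> ast; apply: natr_orb; apply/negP => /andP[/andP[/eqP-> _] /adj_mem].
by rewrite (negPf ast).
Qed.

Lemma below_range st : all (inB B) st -> inB' B (below st).
Proof. by case: st => [|b st] /=; rewrite /inB' /inB; lia. Qed.

Lemma below_neq st i : inB B i -> i \notin st -> below st != i.
Proof.
case: st => [|b st] /=; first by rewrite /inB; lia.
by rewrite inE negb_or eq_sym => _ /andP[].
Qed.

Lemma adj_neq st i j : uniq st -> all (inB B) st -> adj st i j -> j != i.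
Proof.
elim: st => //= a st IH /andP[ast ust] /andP[aB stB] /orP[/andP[/eqP-> /eqP->]|]; last exact: IH.
exact: below_neq.
Qed.

Lemma below_mem (l : seq nat) i : inB B i -> i = below l -> i \in l.
Proof. by case: l => [|b l] /= iB e; rewrite e ?mem_head //; move: iB; rewrite e /inB; lia. Qed.

Lemma adj_split st i j : adj st i j -> (j <= B)%N -> exists l r, st = l ++ i :: j :: r.
Proof.
elim: st => //= a st IH /orP[/andP[/eqP-> /eqP->]|/IH h]; last first.
  by move=> /h[l [r ->]]; exists (a :: l), r.
by case: st {IH} => [|b st] /=; [rewrite ltnn|exists [::], st].
Qed.

(** A move changes the incidence matrix by unit entries at positions (a,b). This lemma and the next
    two give the row, column and floor sums of such an entry. *)
Lemma sum_row_point i a b : inB' B b -> b != a ->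
  \sum_(1 <= j < B.+2 | j != i) ((i == a) && (j == b))%:R = (i == a)%:R :> R.
Proof.
move=> bB ba; case: eqP => [->|_] /=; last by rewrite big1.
by rewrite sum_nat_pred1; move: bB; rewrite /inB' => /andP[-> bB]; rewrite ltnS bB ba.
Qed.

Lemma sum_col_point j a b : inB B a -> b != a ->
  \sum_(1 <= i < B.+1 | i != j) ((i == a) && (j == b))%:R = (j == b)%:R :> R.
Proof.
move=> aB ba; under eq_bigr do rewrite andbC.
case: eqP => [->|_] /=; last by rewrite big1.
by rewrite sum_nat_pred1; move: aB; rewrite /inB => /andP[-> aB]; rewrite ltnS aB eq_sym ba.
Qed.

Lemma sum_floor_point a b : inB B a ->
  \sum_(1 <= i < B.+1) ((i == a) && (B.+1 == b))%:R = (B.+1 == b)%:R :> R.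
Proof.
move=> aB; under eq_bigr do rewrite andbC.
case: eqP => _ /=; last by rewrite big1.
by rewrite sum_nat_pred1; move: aB; rewrite /inB => /andP[-> aB]; rewrite ltnS aB.
Qed.

Lemma sum_adj_row st i : uniq st -> all (inB B) st ->
  \sum_(1 <= j < B.+2 | j != i) (adj st i j)%:R = (i \in st)%:R :> R.
Proof.
elim: st => [_ _|a st IH /= /andP[ast ust] /andP[aB stB]]; first by rewrite big1.
under eq_bigr do rewrite natr_adj_cons //.
rewrite big_split /= IH // sum_row_point ?below_range ?below_neq //.
by rewrite inE natr_orb //; apply/negP => /andP[/eqP-> ]; apply/negP.
Qed.

(** A block carries another one exactly when it is not on top of its stack, whence [behead]. *)
Lemma sum_adj_col st j : inB B j -> uniq st -> all (inB B) st ->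
  \sum_(1 <= i < B.+1 | i != j) (adj st i j)%:R = (j \in behead st)%:R :> R.
Proof.
move=> jB; elim: st => [_ _|a st IH /= /andP[ast ust] /andP[aB stB]]; first by rewrite big1.
under eq_bigr do rewrite natr_adj_cons //.
rewrite big_split /= IH // sum_col_point ?below_neq //.
case: st ust {IH ast stB} => [_|b st /= /andP[bst _]] /=.
  by rewrite addr0; move: jB; rewrite /inB; case: eqP => //; lia.
by rewrite inE natr_orb //; apply/negP => /andP[/eqP-> ]; apply/negP.
Qed.

Lemma sum_adj_floor st : uniq st -> all (inB B) st ->
  \sum_(1 <= i < B.+1) (adj st i B.+1)%:R = (st != [::])%:R :> R.
Proof.
elim: st => [_ _|a st IH /= /andP[ast ust] /andP[aB stB]]; first by rewrite big1.
under eq_bigr do rewrite natr_adj_cons //.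
rewrite big_split /= IH // sum_floor_point //.
case: st stB {IH ast ust} => [_|b st /= /andP[bB _]] /=; first by rewrite eqxx addr0.
by move: bB; rewrite /inB; case: eqP => [<-|_ _]; rewrite ?add0r //; lia.
Qed.

End Adjacency.

(** * Well-formed configurations and the effect of one move on the incidence matrix *)

Section Configurations.
Variables (R : realFieldType) (B S : nat).
Implicit Types (c : config S) (s d : 'I_S) (i j : nat).

(** The part of [valid_config] that survives all legal moves: blocks may be missing, but none is
    repeated. *)
Record wf c : Prop := Wf {
  wf_uniq : forall s, uniq (c s);
  wf_disj : forall s s' b, b \in c s -> b \in c s' -> s = s';
  wf_range : forall s, all (inB B) (c s)
}.

Definition present c i : bool := [exists s, i \in c s].
Definition topmost c i : bool := [exists s, ohead (c s) == Some i].

Lemma wf_inB c s i : wf c -> i \in c s -> inB B i.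
Proof. by move=> /wf_range/(_ s)/allP; apply. Qed.

Lemma lies_on_adj c i j : lies_on B c i j = [exists s, adj B (c s) i j].
Proof. by apply: eq_existsb => s; rewrite infix_adj. Qed.

Lemma natr_lies_on c i j : wf c ->
  (lies_on B c i j)%:R = \sum_s (adj B (c s) i j)%:R :> R.
Proof.
move=> cwf; rewrite lies_on_adj natr_exists // => s s' /adj_mem is_ /adj_mem is'.
exact: wf_disj is_ is'.
Qed.

Lemma lies_on_present c i j : lies_on B c i j -> present c i.
Proof. by rewrite lies_on_adj => /existsP[s /adj_mem si]; apply/existsP; exists s. Qed.

Lemma natr_present c i : wf c -> (present c i)%:R = \sum_s (i \in c s)%:R :> R.
Proof. by move=> cwf; rewrite natr_exists // => s s'; apply: wf_disj. Qed.

Lemma ohead_mem c s i : ohead (c s) == Some i -> i \in c s.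
Proof. by case: (c s) => //= a st /eqP[->]; rewrite mem_head. Qed.

Lemma topmost_present c i : topmost c i -> present c i.
Proof. by case/existsP => s /ohead_mem is_; apply/existsP; exists s. Qed.

Lemma natr_topmost c i : wf c -> (topmost c i)%:R = \sum_s (ohead (c s) == Some i)%:R :> R.
Proof.
by move=> cwf; rewrite natr_exists // => s s' /ohead_mem h /ohead_mem; apply: wf_disj h.
Qed.

Lemma sum_lies_on_row c i : wf c ->
  \sum_(1 <= j < B.+2 | j != i) (lies_on B c i j)%:R = (present c i)%:R :> R.
Proof.
move=> cwf; under eq_bigr do rewrite natr_lies_on //.
rewrite exchange_big natr_present //; apply: eq_bigr => s _.
by rewrite sum_adj_row ?wf_uniq ?wf_range.
Qed.

(** Together with the row sum, this shows that the right-hand sides of (yhat4) and (ycheck4), row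
    minus column, are the indicator of being topmost. *)
Lemma sum_lies_on_col c j : wf c -> inB B j ->
  \sum_(1 <= i < B.+1 | i != j) (lies_on B c i j)%:R
  = (present c j)%:R - (topmost c j)%:R :> R.
Proof.
move=> cwf jB; under eq_bigr do rewrite natr_lies_on //.
rewrite exchange_big natr_present // natr_topmost // -sumrB; apply: eq_bigr => s _.
rewrite sum_adj_col ?wf_uniq ?wf_range //; move: (wf_uniq cwf s).
case: (c s) => [_|a st /= /andP[ast _]]; first by rewrite subr0.
rewrite inE (inj_eq Some_inj) [a == j]eq_sym natr_orb; first lra.
by apply/negP => /andP[/eqP->]; apply/negP.
Qed.

Lemma sum_lies_on_floor c : wf c ->
  \sum_(1 <= i < B.+1) (lies_on B c i B.+1)%:R = \sum_s (c s != [::])%:R :> R.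
Proof.
move=> cwf; under eq_bigr do rewrite natr_lies_on //.
rewrite exchange_big; apply: eq_bigr => s _.
by rewrite sum_adj_floor ?wf_uniq ?wf_range.
Qed.

Lemma relocE c s d a st : c s = a :: st ->
  next c (Reloc s d) = [ffun k => if k == s then st else if k == d then a :: c d else c k].
Proof. by move=> cs; apply/ffunP => k; rewrite !ffunE cs /= take0. Qed.

Lemma retrE c s a st : c s = a :: st ->
  next c (Retr s) = [ffun k => if k == s then st else c k].
Proof. by move=> cs; apply/ffunP => k; rewrite !ffunE cs. Qed.

Lemma wf_top_notin c s a st : wf c -> c s = a :: st -> a \notin st.
Proof. by move=> cwf cs; have := wf_uniq cwf s; rewrite cs => /= /andP[]. Qed.

Lemma wf_top_range c s a st : wf c -> c s = a :: st -> inB B a /\ all (inB B) st.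
Proof. by move=> cwf cs; have := wf_range cwf s; rewrite cs => /= /andP[]. Qed.

Lemma wf_top_other c s k a st : wf c -> c s = a :: st -> s != k -> a \notin c k.
Proof.
move=> cwf cs sk; apply/negP => ak; case/eqP: sk; apply: wf_disj ak => //.
by rewrite cs mem_head.
Qed.

Lemma wf_reloc c s d a st : wf c -> c s = a :: st -> s != d -> wf (next c (Reloc s d)).
Proof.
move=> cwf cs sd; rewrite (relocE d cs).
have ast := wf_top_notin cwf cs; have [aB stB] := wf_top_range cwf cs.
have us : uniq st by have := wf_uniq cwf s; rewrite cs => /= /andP[].
(* After the move, a block of stack [k] is either the moved block on its destination or another
   block that was already in [k]. *)
have origin k b : b \in (if k == s then st else if k == d then a :: c d else c k) ->
  b = a /\ k = d \/ b != a /\ b \in c k.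
  case: eqP => [->|/eqP ks] bk.
    right; split; last by rewrite cs inE bk orbT.
    by apply: contra ast => /eqP<-.
  move: bk; case: eqP => [->|/eqP kd].
    rewrite inE; case: eqP => [-> _|/eqP ba /= bd]; first by left.
    by right.
  move=> bk; right; split=> //; apply: contraTN bk => /eqP->.
  by rewrite (wf_top_other cwf cs) // eq_sym.
split=> k; rewrite ?ffunE.
- case: ifP => // _; case: ifP => _; last exact: wf_uniq cwf k.
  by rewrite /= wf_uniq // andbT (wf_top_other cwf cs).
- move=> k' b; rewrite !ffunE => /origin[[-> ->]|[ba bk]] /origin[[ba' ->]|[ba' bk']] //.
  + by rewrite eqxx in ba'.
  + by rewrite ba' eqxx in ba.
  + exact: wf_disj bk bk'.
- case: ifP => // _; case: ifP => _; last exact: wf_range cwf k.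
  by rewrite /= aB wf_range.
Qed.

Lemma wf_retr c s : wf c -> wf (next c (Retr s)).
Proof.
move=> cwf; have sub k b : b \in next c (Retr s) k -> b \in c k.
  by rewrite ffunE; case: eqP => [->|//]; apply: mem_behead.
split=> k; last by apply/allP => b /sub; apply: wf_inB.
- rewrite ffunE; case: eqP => [_|_]; last exact: wf_uniq.
  by have := wf_uniq cwf s; case: (c s) => //= ? ? /andP[].
- by move=> k' b /sub h /sub; apply: wf_disj h.
Qed.

Lemma natr_lies_on_reloc c s d a st i j : wf c -> c s = a :: st -> s != d ->
  (lies_on B (next c (Reloc s d)) i j)%:R = (lies_on B c i j)%:R
    - ((i == a) && (j == below B st))%:R + ((i == a) && (j == below B (c d)))%:R :> R.
Proof.
move=> cwf cs sd; have ds : d != s by rewrite eq_sym.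
rewrite !natr_lies_on //; last exact: wf_reloc cs sd.
(* Only the source and the destination change, so the remaining stacks cancel. *)
pose rest (c' : config S) := \sum_(k | (k != s) && (k != d)) (adj B (c' k) i j)%:R : R.
have split2 c' : \sum_k (adj B (c' k) i j)%:R
    = (adj B (c' s) i j)%:R + (adj B (c' d) i j)%:R + rest c'.
  by rewrite (bigD1 s) // (bigD1 d) //= addrA.
rewrite !split2; have -> : rest (next c (Reloc s d)) = rest c.
  by apply: eq_bigr => k /andP[ks kd]; rewrite ffunE (negPf ks) (negPf kd).
rewrite (relocE d cs) !ffunE !eqxx (negPf ds) cs.
rewrite !natr_adj_cons ?(wf_top_notin cwf cs) ?(wf_top_other cwf cs) //; lra.
Qed.

Lemma natr_lies_on_retr c s a st i j : wf c -> c s = a :: st ->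
  (lies_on B (next c (Retr s)) i j)%:R
  = (lies_on B c i j)%:R - ((i == a) && (j == below B st))%:R :> R.
Proof.
move=> cwf cs; rewrite !natr_lies_on //; last exact: wf_retr.
pose rest (c' : config S) := \sum_(k | k != s) (adj B (c' k) i j)%:R : R.
have split1 c' : \sum_k (adj B (c' k) i j)%:R = (adj B (c' s) i j)%:R + rest c'.
  by rewrite (bigD1 s).
rewrite !split1; have -> : rest (next c (Retr s)) = rest c.
  by apply: eq_bigr => k ks; rewrite ffunE (negPf ks).
rewrite (retrE cs) !ffunE !eqxx cs natr_adj_cons ?(wf_top_notin cwf cs) //; lra.
Qed.

End Configurations.

(** * Move sequences, turns and the balance equations *)

Section Turns.
Variables (R : realFieldType) (B S H : nat).
Implicit Types (c : config S) (s d : 'I_S) (i j : nat) (ms : seq (move S)).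

Lemma exec_cat c ms ms' : exec c (ms ++ ms') = exec (exec c ms) ms'.
Proof. by rewrite /exec foldl_cat. Qed.

Lemma exec_cons c mv ms : exec c (mv :: ms) = exec (next c mv) ms.
Proof. by []. Qed.

Lemma occurs_cons ev c mv ms : occurs ev c (mv :: ms) = ev c mv || occurs ev (next c mv) ms.
Proof. by []. Qed.

Lemma legal_seq_cat c ms ms' :
  legal_seq H c (ms ++ ms') = legal_seq H c ms && legal_seq H (exec c ms) ms'.
Proof. by elim: ms c => //= mv ms IH c; rewrite IH andbA. Qed.

Lemma occurs_cat ev c ms ms' :
  occurs ev c (ms ++ ms') = occurs ev c ms || occurs ev (exec c ms) ms'.
Proof. by elim: ms c => //= mv ms IH c; rewrite IH orbA. Qed.

Lemma legal_retrP c s : legal H c (Retr s) ->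
  exists a st, c s = a :: st /\ forall k b, b \in c k -> (a <= b)%N.
Proof.
rewrite /=; case cs: (c s) => [//|a st] /forallP amin.
by exists a, st; split=> // k b; apply/allP.
Qed.

Lemma legal_relocP c s d : legal H c (Reloc s d) ->
  exists a st, [/\ c s = a :: st, s != d & (size (c d) < H)%N].
Proof. by case/and3P => sd; case cs: (c s) => [//|a st] _ dH; exists a, st. Qed.

Lemma wf_next c mv : wf B c -> legal H c mv -> wf B (next c mv).
Proof.
move=> cwf; case: mv => [s d|s]; last by move=> _; apply: wf_retr.
by case/legal_relocP => a [st [cs sd _]]; apply: wf_reloc cs sd.
Qed.

Lemma wf_exec c ms : wf B c -> legal_seq H c ms -> wf B (exec c ms).
Proof.
elim: ms c => //= mv ms IH c cwf /andP[leg legs]; apply: IH => //.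
exact: wf_next leg.
Qed.

Lemma lies_on_top c s a st j : wf B c -> c s = a :: st ->
  lies_on B c a j = (j == below B st).
Proof.
move=> cwf cs; rewrite lies_on_adj; apply/existsP/idP => [[s' adjs']|jb]; last first.
  by exists s; rewrite cs /= eqxx jb.
have as' := adj_mem adjs'.
have es : s' = s by apply: (wf_disj cwf as'); rewrite cs mem_head.
move: adjs'; rewrite es cs /= eqxx => /orP[//|/adj_mem].
by rewrite (negPf (wf_top_notin cwf cs)).
Qed.

Lemma occurs_lifts_retr c rs i j :
  occurs (lifts B i j) c (map (@Retr S) rs) = false.
Proof. by elim: rs c => //= s rs IH c; rewrite IH. Qed.

Lemma occurs_puts_retr c rs i j :
  occurs (puts B i j) c (map (@Retr S) rs) = false.
Proof. by elim: rs c => //= s rs IH c; rewrite IH. Qed.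

Lemma retrieves_top c s a st i j : c s = a :: st ->
  retrieves B i j c (Retr s) = (i == a) && (j == below B st).
Proof. by rewrite /retrieves => ->; rewrite prefix_below. Qed.

Lemma lifts_top c s d a st i j : c s = a :: st ->
  lifts B i j c (Reloc s d) = (i == a) && (j == below B st).
Proof. by rewrite /lifts => ->; rewrite prefix_below. Qed.

Lemma puts_top c s d a st i j : c s = a :: st ->
  puts B i j c (Reloc s d) = (i == a) && (j == below B (c d)).
Proof.
rewrite /puts => -> /=; rewrite (inj_eq Some_inj) eq_sym; congr (_ && _).
by rewrite /with_floor; case: (c d) => [|b st'] /=; rewrite (inj_eq Some_inj) eq_sym.
Qed.

Lemma natr_lies_on_retrs c rs i j : wf B c -> legal_seq H c (map (@Retr S) rs) ->
  (lies_on B (exec c (map (@Retr S) rs)) i j)%:R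
  = (lies_on B c i j)%:R - (occurs (retrieves B i j) c (map (@Retr S) rs))%:R :> R.
Proof.
elim: rs c => [|s rs IH] c cwf; first by rewrite subr0.
move=> /andP[leg legs]; have [a [st [cs _]]] := legal_retrP leg.
have := IH _ (wf_retr s cwf) legs; rewrite (natr_lies_on_retr _ _ _ cwf cs).
rewrite map_cons exec_cons occurs_cons (retrieves_top _ _ cs).
(* Both events cannot occur: [lies_on] would drop below 0. Hence the disjunction of the events
   counts as their sum. *)
by case: (lies_on B c i j); case: lies_on; case: (_ && _); case: occurs => /=; lra.
Qed.

(** An optional relocation (source, destination), then the stacks retrieved from. The type itself
    enforces the order of moves that [turns_of] asks for. *)
Definition turn : Type := (option ('I_S * 'I_S) * seq 'I_S)%type.

Definition reloc_moves (o : option ('I_S * 'I_S)) : seq (move S) :=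
  if o is Some (s, d) then [:: Reloc s d] else [::].

Definition turn_moves (tr : turn) : seq (move S) :=
  reloc_moves tr.1 ++ map (@Retr S) tr.2.

Lemma turn_lifts c tr i j :
  occurs (lifts B i j) c (turn_moves tr) = occurs (lifts B i j) c (reloc_moves tr.1).
Proof. by rewrite occurs_cat occurs_lifts_retr orbF. Qed.

Lemma turn_puts c tr i j :
  occurs (puts B i j) c (turn_moves tr) = occurs (puts B i j) c (reloc_moves tr.1).
Proof. by rewrite occurs_cat occurs_puts_retr orbF. Qed.

Lemma turn_retrieves c tr i j : occurs (retrieves B i j) c (turn_moves tr)
  = occurs (retrieves B i j) (exec c (reloc_moves tr.1)) (map (@Retr S) tr.2).
Proof. by rewrite occurs_cat; case: tr => [[[s d]|] rs]. Qed.

Lemma is_reloc_turn tr : map (@is_reloc S) (turn_moves tr)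
  = nseq (isSome tr.1) true ++ nseq (size tr.2) false.
Proof. by case: tr => [[[s d]|] rs] /=; elim: rs => //= s' rs [->]. Qed.

Lemma nreloc_turn tr : nreloc (turn_moves tr) = isSome tr.1.
Proof.
rewrite /nreloc -[LHS]/(count (preim (@is_reloc S) id) _) -count_map is_reloc_turn.
by rewrite count_cat !count_nseq /= mul0n addn0 mul1n.
Qed.

Lemma natr_lies_on_mid c o i j : wf B c -> legal_seq H c (reloc_moves o) ->
  (lies_on B (exec c (reloc_moves o)) i j)%:R = (lies_on B c i j)%:R
    - (occurs (lifts B i j) c (reloc_moves o))%:R
    + (occurs (puts B i j) c (reloc_moves o))%:R :> R.
Proof.
case: o => [[s d]|] cwf; last by rewrite /= subr0 addr0.
rewrite [legal_seq _ _ _]/= andbT => /legal_relocP[a [st [cs sd _]]].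
rewrite !occurs_cons !orbF.
rewrite (lifts_top d i j cs) (puts_top d i j cs) (natr_lies_on_reloc _ _ _ cwf cs) //.
Qed.

Lemma natr_lies_on_turn c tr i j : wf B c -> legal_seq H c (turn_moves tr) ->
  (lies_on B (exec c (turn_moves tr)) i j)%:R = (lies_on B c i j)%:R
    - (occurs (lifts B i j) c (turn_moves tr))%:R
    + (occurs (puts B i j) c (turn_moves tr))%:R
    - (occurs (retrieves B i j) c (turn_moves tr))%:R :> R.
Proof.
move=> cwf; rewrite legal_seq_cat => /andP[leg1 leg2].
rewrite turn_lifts turn_puts turn_retrieves exec_cat natr_lies_on_retrs //.
  by rewrite natr_lies_on_mid.
exact: wf_exec leg1.
Qed.

End Turns.

(** * From solutions to move sequences *)

Section NaturalSums.
Variable R : realFieldType.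

Definition natural (a : R) : Prop := exists n : nat, a = n%:R.

Lemma binary_natural a : binary a -> natural a.
Proof. by case=> ->; [exists 0%N | exists 1%N]. Qed.

Lemma binary_bool (b : bool) : binary (b%:R : R).
Proof. by case: b; [right|left]. Qed.

Lemma natural_ge0 a : natural a -> 0 <= a.
Proof. by case=> n ->; apply: ler0n. Qed.

Lemma binary_ge0 (a : R) : binary a -> 0 <= a.
Proof. by move/binary_natural/natural_ge0. Qed.

Lemma natural_le1 a : natural a -> a <= 1 -> binary a.
Proof. by case=> -[|[|n]] ->; [left|right|rewrite lern1]. Qed.

Lemma natural_sum (r : seq nat) (P : pred nat) (F : nat -> R) :
  (forall i, i \in r -> P i -> natural (F i)) -> natural (\sum_(i <- r | P i) F i).
Proof.
move=> Fnat; rewrite big_seq_cond; apply: big_ind => [|_ _ [m ->] [n ->]|i /andP[]].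
- by exists 0%N.
- by exists (m + n)%N; rewrite natrD.
- exact: Fnat.
Qed.

Lemma nonneg_sum0 (r : seq nat) (P : pred nat) (F : nat -> R) :
  (forall i, i \in r -> P i -> 0 <= F i) -> \sum_(i <- r | P i) F i <= 0 ->
  forall i, i \in r -> P i -> F i = 0.
Proof.
move=> F0 s0 i ir Pi; apply/eqP; rewrite eq_le F0 // andbT; apply: le_trans s0.
rewrite (big_rem i) //= Pi lerDl big_seq_cond; apply: sumr_ge0 => k /andP[/mem_rem].
exact: F0.
Qed.

(** Some term is nonzero, hence at least 1 by integrality, and the nonnegative rest must vanish. *)
Lemma natural_sum1 (r : seq nat) (P : pred nat) (F : nat -> R) : uniq r ->
  (forall i, i \in r -> P i -> natural (F i)) -> \sum_(i <- r | P i) F i = 1 ->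
  exists i0, [/\ i0 \in r, P i0, F i0 = 1 &
    forall i, i \in r -> P i -> i != i0 -> F i = 0].
Proof.
move=> ur Fnat s1; have [/hasP[i0 i0r /andP[Pi0 Fi0]]|none] :=
  boolP (has (fun i => P i && (F i != 0)) r); last first.
  move: s1; rewrite big_seq_cond big1 => [/esym/eqP|i /andP[ir Pi]].
    by rewrite oner_eq0.
  by apply/eqP; apply: contraNT none => Fi; apply/hasP; exists i => //; rewrite Pi.
move: s1; rewrite (big_rem i0) //= Pi0.
set rest := \sum_(i <- _ | _) F i => s1.
have F0 i : i \in rem i0 r -> P i -> 0 <= F i.
  by move=> /mem_rem ir Pi; apply: natural_ge0; apply: Fnat.
have rest0 : 0 <= rest by rewrite /rest big_seq_cond; apply: sumr_ge0 => i /andP[]; apply: F0.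
have [n Fn] := Fnat _ i0r Pi0.
have n1 : 1 <= F i0 by rewrite Fn ler1n lt0n -(pnatr_eq0 R) -Fn.
exists i0; split=> //; first by lra.
move=> i ir Pi ii0; apply: (nonneg_sum0 F0) => //; first by rewrite -/rest; lra.
by rewrite mem_rem_uniq // inE ii0.
Qed.

Lemma eq_sum_row (B i : nat) (F G : nat -> R) :
  (forall j, inB' B j -> j != i -> F j = G j) ->
  \sum_(1 <= j < B.+2 | j != i) F j = \sum_(1 <= j < B.+2 | j != i) G j.
Proof.
move=> FG; rewrite big_nat_cond [RHS]big_nat_cond.
by apply: eq_bigr => j /andP[jB ji]; apply: FG.
Qed.

Lemma eq_sum_col (B : nat) (P : pred nat) (F G : nat -> R) :
  (forall i, inB B i -> P i -> F i = G i) ->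
  \sum_(1 <= i < B.+1 | P i) F i = \sum_(1 <= i < B.+1 | P i) G i.
Proof.
move=> FG; rewrite big_nat_cond [RHS]big_nat_cond.
by apply: eq_bigr => j /andP[jB ji]; apply: FG.
Qed.

Lemma sum_row_upper (B i : nat) (F : nat -> R) :
  \sum_(1 <= j < B.+2 | (i < j)%N) F j
  = \sum_(1 <= j < B.+2 | j != i) (if (i < j)%N then F j else 0).
Proof.
rewrite big_mkcond [RHS]big_mkcond; apply: eq_bigr => j _.
by case: ltnP => [ij|_]; [rewrite gtn_eqF|case: ifP].
Qed.

(** The witness [r] is the last index where [P] fails, or 0. It describes the blocks present before
    and after a turn, and the turns without relocation. *)
Lemma threshold (n : nat) (P : pred nat) :
  (forall i, (0 < i < n)%N -> P i -> P i.+1) ->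
  exists2 r, (r <= n)%N & forall i, (1 <= i <= n)%N -> P i = (r < i)%N.
Proof.
elim: n => [_|n IH up]; first by exists 0%N => // i; lia.
have [i /andP[i0 lin]|r rn rP] := IH; first by apply: up; lia.
have [Pn|Pn] := boolP (P n.+1).
  exists r => [|i iB]; first by lia.
  by have [->|ne] := eqVneq i n.+1; [rewrite Pn; lia|rewrite rP //; lia].
exists n.+1 => // i iB; have -> : (n.+1 < i)%N = false by lia.
have [->|ne] := eqVneq i n.+1; first exact: negbTE.
rewrite rP; last by lia.
apply: contraNF Pn => ri; have Pn : P n by rewrite rP; lia.
by apply: up => //; lia.
Qed.

Lemma sum_leq_nat (r n : nat) : (r <= n)%N -> (\sum_(1 <= t < n.+1) (t <= r) = r)%N.
Proof.
move=> rn; rewrite (big_cat_nat (n := r.+1)) //= [X in (_ + X)%N]big_nat_cond.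
rewrite [X in (_ + X)%N]big1 => [|t tT]; last by rewrite leqNgt; case: ltnP => //; lia.
rewrite big_nat_cond (eq_bigr (fun _ => 1%N)) => [|t tT]; last by case: leqP => //; lia.
by rewrite -big_nat_cond sum_nat_const_nat muln1 subSS subn0 addn0.
Qed.

End NaturalSums.

(** * Row sums of x in terms of the retrievals so far *)

Section RowSums.
Variables (R : realFieldType) (B S T : nat) (c0 : config S) (v : solution R).
Hypothesis c0_wf : wf B c0.
Hypothesis c0_present : forall i, inB B i -> present c0 i.
Hypothesis x1 : forall i j, inB B i -> inB' B j -> j != i ->
  vx v i j 0 = initC R B c0 i j.
Hypothesis x2 : forall i j t, inB B i -> inB' B j -> (j < i)%N -> inT T t ->
  vx v i j t = vx v i j t.-1 - yhat v i j t + ycheck v i j t.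
Hypothesis x3 : forall i j t, inB B i -> inB' B j -> (i < j)%N -> inT T t ->
  vx v i j t = vx v i j t.-1 - yhat v i j t + ycheck v i j t - vz v i j t.
Hypothesis ycheck1 : forall i t, inB B i -> inT T t ->
  \sum_(1 <= j < B.+2 | j != i) ycheck v i j t
  = \sum_(1 <= j < B.+2 | j != i) yhat v i j t.

(** By (ycheck1) lifts and put-downs cancel within a row, so only retrievals change its sum. *)
Lemma x_row_step i t : inB B i -> inT T t ->
  \sum_(1 <= j < B.+2 | j != i) vx v i j t
  = \sum_(1 <= j < B.+2 | j != i) vx v i j t.-1
    - \sum_(1 <= j < B.+2 | (i < j)%N) vz v i j t.
Proof.
move=> iB tT; have := ycheck1 iB tT; rewrite sum_row_upper.
rewrite (eq_sum_row (F := fun j => vx v i j t) (G := fun j => vx v i j t.-1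
   - yhat v i j t + ycheck v i j t - (if (i < j)%N then vz v i j t else 0))).
  by rewrite !sumrB big_split /= sumrB => ->; lra.
move=> j jB ji; case: ltnP => ij; first exact: x3.
by rewrite subr0; apply: x2 => //; rewrite ltn_neqAle ji.
Qed.

Lemma x_row i t : inB B i -> (t <= T)%N ->
  \sum_(1 <= j < B.+2 | j != i) vx v i j t
  = 1 - \sum_(1 <= j < B.+2 | (i < j)%N) \sum_(1 <= tau < t.+1) vz v i j tau.
Proof.
move=> iB; elim: t => [_|t IH tT].
  rewrite (eq_sum_row (G := fun j => (lies_on B c0 i j)%:R)).
    by rewrite sum_lies_on_row // c0_present // big1 ?subr0 // => j _; rewrite big_geq.
  by move=> j jB ji; rewrite x1.
rewrite x_row_step //= IH; last by lia.
under [in RHS]eq_bigr do rewrite big_nat_recr //=.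
by rewrite big_split /=; lra.
Qed.

End RowSums.

(** * Retrieving a range of consecutive labels *)

Section Retrievals.
Variables B S H : nat.
Implicit Types (c : config S) (s d : 'I_S) (i j : nat).

(** Presence is a row sum of the incidence matrix, so the matrix identity, taken over the rationals,
    decides it. *)
Lemma present_retr c s a st i : wf B c -> c s = a :: st ->
  present (next c (Retr s)) i = present c i && (i != a).
Proof.
move=> cwf cs; apply: (@natr_bool_inj rat).
rewrite -(sum_lies_on_row rat i (wf_retr s cwf)).
have ast := wf_top_notin cwf cs; have [aB stB] := wf_top_range cwf cs.
under eq_bigr do rewrite (natr_lies_on_retr _ _ _ cwf cs).
rewrite sumrB sum_lies_on_row // sum_row_point ?below_range ?below_neq //.
have [->|_] := eqVneq i a; last by rewrite andbT subr0.
have -> : present c a by apply/existsP; exists s; rewrite cs mem_head.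
by rewrite subrr.
Qed.

Lemma present_reloc c s d a st i : wf B c -> c s = a :: st -> s != d ->
  present (next c (Reloc s d)) i = present c i.
Proof.
move=> cwf cs sd; apply: (@natr_bool_inj rat).
rewrite -(sum_lies_on_row rat i (wf_reloc cwf cs sd)).
have ast := wf_top_notin cwf cs; have [aB stB] := wf_top_range cwf cs.
under eq_bigr do rewrite (natr_lies_on_reloc _ _ _ cwf cs sd).
rewrite big_split sumrB /= sum_lies_on_row // !sum_row_point ?below_range ?below_neq ?wf_range //
  ?(wf_top_other cwf cs) // subrK //.
Qed.

(** A retrieved block has the smallest remaining label, so it cannot rest on a smaller one. This is
    why z is only indexed by pairs with i < j. *)
Lemma occurs_retrieves_lt c rs i j : wf B c -> legal_seq H c (map (@Retr S) rs) ->
  (j < i)%N -> occurs (retrieves B i j) c (map (@Retr S) rs) = false.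
Proof.
move=> + + ji; elim: rs c => [//|s rs IH] c cwf /andP[leg legs].
rewrite map_cons occurs_cons (IH _ (wf_retr s cwf) legs) orbF.
have [a [st [cs amin]]] := legal_retrP leg; rewrite (retrieves_top _ _ _ cs).
apply/negP => /andP[/eqP ia /eqP jb]; have [aB _] := wf_top_range cwf cs.
case: st cs jb => [|b st] cs /= jb; first by move: aB; rewrite /inB; lia.
by have := amin s b; rewrite cs !inE eqxx orbT => /(_ isT); lia.
Qed.

(* The blocks r < i <= r' are to be retrieved, block i from the j with Z i j. *)
Lemma retrieval_phase c (Z : rel nat) r r' : wf B c -> (r <= r' <= B)%N ->
  (forall i, inB B i -> present c i = (r < i)%N) ->
  (forall i j, inB B i -> inB' B j -> (i < j)%N -> Z i j ->
     lies_on B c i j && (r < i <= r')%N) ->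
  (forall i, (r < i <= r')%N -> exists j, [/\ inB' B j, (i < j)%N & Z i j]) ->
  (forall k i, inB B k -> inB B i -> (i < k)%N -> (i <= r')%N -> ~~ lies_on B c k i) ->
  exists2 rs, legal_seq H c (map (@Retr S) rs) &
    forall i j, inB B i -> inB' B j -> (i < j)%N ->
      occurs (retrieves B i j) c (map (@Retr S) rs) = Z i j.
Proof.
move: {2}(r' - r)%N (erefl (r' - r)%N) => n.
elim: n c Z r => [|n IH] c Z r rn cwf rB pres Zon Zex bare.
  exists [::] => // i j iB jB ij; apply/esym/negbTE/negP => Zij.
  by have /andP[_] := Zon i j iB jB ij Zij; lia.
(* The smallest remaining block comes next. Smaller blocks are gone and [bare] keeps larger ones off
   it, so its column sum is 0 and it is topmost. *)
pose a := r.+1; have aB : inB B a by rewrite /inB /a; lia.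
have top_a : topmost c a.
  have : \sum_(1 <= k < B.+1 | k != a) (lies_on B c k a)%:R = 0 :> rat.
    rewrite big_nat_cond big1 // => k /andP[kB ka].
    have [ka_on|//] := boolP (lies_on B c k a).
    have := lies_on_present ka_on; rewrite pres // => rk.
    by have := bare k a kB aB; rewrite ka_on => /(_ _ _)/negP[]; move: ka rk; rewrite /a; lia.
  rewrite sum_lies_on_col // pres // ltnSn.
  by case: (topmost c a) => //= /eqP; rewrite subr0 oner_eq0.
have [s /eqP cs0] := existsP top_a.
have [st cs] : exists st, c s = a :: st by case: (c s) cs0 => //= b st [->]; exists st.
have onE j : lies_on B c a j = (j == below B st) by rewrite (lies_on_top _ cwf cs).
have leg : legal H c (Retr s).
  rewrite /= cs; apply/forallP => k; apply/allP => b bk.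
  by rewrite /a -pres ?(wf_inB cwf bk) //; apply/existsP; exists k.
(* [Zex] provides some support of [a] and [Zon] makes it the actual one, which is unique. *)
have Za j : inB' B j -> (a < j)%N -> Z a j = (j == below B st).
  move=> jB aj; apply/idP/eqP => [Zaj|jE].
    by have /andP[] := Zon a j aB jB aj Zaj; rewrite onE => /eqP.
  have [|j' [j'B aj' Zaj']] := Zex a; first by rewrite /a; lia.
  by have /andP[] := Zon a j' aB j'B aj' Zaj'; rewrite onE => /eqP j'E _; rewrite jE -j'E.
have on1 i j : lies_on B (next c (Retr s)) i j -> lies_on B c i j.
  have := natr_lies_on_retr rat i j cwf cs.
  by case: (lies_on B c i j) => //; case: lies_on => //; case: (_ && _) => /=; lra.
have on1' i j : i != a -> lies_on B (next c (Retr s)) i j = lies_on B c i j.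
  move=> ia; have := natr_lies_on_retr rat i j cwf cs.
  by rewrite (negPf ia) subr0 => /natr_bool_inj.
(* The row of [a] is cleared from [Z], because [a] has left the configuration. *)
have [|||||||rs legs rsZ] := IH (next c (Retr s)) (fun i j => Z i j && (i != a)) a.
- by rewrite /a; lia.
- exact: wf_retr.
- by rewrite /a; lia.
- by move=> i iB; rewrite (present_retr i cwf cs) pres // /a; lia.
- move=> i j iB jB ij /andP[Zij ia]; rewrite on1' //.
  by have /andP[-> /=] := Zon i j iB jB ij Zij; move: ia; rewrite /a; lia.
- move=> i ri; have [|j [jB ij Zij]] := Zex i; first by rewrite /a in ri; lia.
  by exists j; split=> //; rewrite Zij; rewrite /a in ri *; lia.
- move=> k i kB iB ik ir; apply: contra (bare k i kB iB ik ir); exact: on1.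
exists (s :: rs); first by rewrite map_cons -[legal_seq _ _ _]/(_ && _) leg.
move=> i j iB jB ij; rewrite map_cons occurs_cons (retrieves_top _ _ _ cs) rsZ //.
have [ia|_] := eqVneq i a; last by rewrite andbT.
by rewrite andbF orbF ia Za // -ia.
Qed.

End Retrievals.

(** * Decoding a feasible solution turn by turn *)

Section Decoding.
Variables (R : realFieldType) (B S H L T : nat) (c0 : config S) (v : solution R).
Hypothesis c0_wf : wf B c0.
Hypothesis c0_present : forall i, inB B i -> present c0 i.
Hypothesis L_gt0 : (0 < L)%N.
Hypothesis com : common B H L T c0 v.
Hypothesis x01 : forall i j t, inB B i -> inB' B j -> j != i -> (t <= T)%N ->
  0 <= vx v i j t <= 1.
Hypothesis u1H : forall i t, inB B i -> inT T t -> 1 <= vu v i t <= H%:R.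

Lemma mem_B i : (i \in index_iota 1 B.+1) = inB B i.
Proof. by rewrite mem_index_iota ltnS. Qed.

Lemma mem_B' i : (i \in index_iota 1 B.+2) = inB' B i.
Proof. by rewrite mem_index_iota ltnS. Qed.

Definition lift_total t : R :=
  \sum_(1 <= i < B.+1) \sum_(1 <= j < B.+2 | j != i) yhat v i j t.

Lemma yhat_row_natural i t : inB B i -> inT T t ->
  natural (\sum_(1 <= j < B.+2 | j != i) yhat v i j t).
Proof.
move=> iB tT; apply: natural_sum => j; rewrite mem_B' => jB ji.
exact/binary_natural/(cons_yhat5 com).
Qed.

(** The total is 1 up to turn [L] by (yhat1), and a natural number that cannot increase afterwards
    by (yhat2). Positivity of [L] keeps the index t-1 in (yhat2) among the turns. *)
Lemma lift_total_binary t : inT T t -> binary (lift_total t).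
Proof.
elim: t => [//|t IH] tT; have [tL|tL] := leqP t.+1 L.
  by right; apply: (cons_yhat1 com).
apply: natural_le1.
  by apply: natural_sum => i; rewrite mem_B => iB _; apply: yhat_row_natural.
apply: (le_trans (cons_yhat2 com tT tL)) => /=.
have tT' : inT T t by move: tT; rewrite /inT; lia.
by case: (IH tT') => e; rewrite -/(lift_total t) e.
Qed.

(** Each row sum is 1 minus the retrievals so far, so this is (z3) read on rows. *)
Lemma x_row_mono i t : inB B i -> inB B i.+1 -> (t <= T)%N ->
  \sum_(1 <= j < B.+2 | j != i) vx v i j t
  <= \sum_(1 <= j < B.+2 | j != i.+1) vx v i.+1 j t.
Proof.
move=> iB iB' tT; have rows k kB := x_row c0_wf c0_present (cons_x1 com) (cons_x2 com) (cons_x3 com)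
  (cons_ycheck1 com) (i := k) kB tT.
rewrite !rows // {rows} lerD2l lerN2.
case: t tT => [_|t tT].
  by rewrite !big1 // => j _; rewrite big_geq.
by apply: (cons_z3 com (i := i.+1)) => //; move: iB; rewrite /inB; lia.
Qed.

Definition matches (c : config S) t : Prop :=
  forall i j, inB B i -> inB' B j -> j != i -> vx v i j t = (lies_on B c i j)%:R.

Lemma matches_row c t i : wf B c -> matches c t -> inB B i ->
  \sum_(1 <= j < B.+2 | j != i) vx v i j t = (present c i)%:R.
Proof.
move=> cwf cx iB; rewrite -(sum_lies_on_row R i cwf).
by apply: eq_sum_row => j jB ji; apply: cx.
Qed.

Lemma matches_col c t j : wf B c -> matches c t -> inB B j ->
  \sum_(1 <= i < B.+1 | i != j) vx v i j t = (present c j)%:R - (topmost c j)%:R.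
Proof.
move=> cwf cx jB; rewrite -(sum_lies_on_col R cwf jB).
apply: eq_sum_col => i iB ij; apply: cx => //; last by rewrite eq_sym.
by move: jB; rewrite /inB /inB'; lia.
Qed.

Lemma matches_floor c t : wf B c -> matches c t ->
  \sum_(1 <= i < B.+1) vx v i B.+1 t = \sum_s (c s != [::])%:R.
Proof.
move=> cwf cx; rewrite -(sum_lies_on_floor R cwf).
by apply: eq_sum_col => i iB _; apply: cx => //; move: iB; rewrite /inB /inB'; lia.
Qed.

(** The value u is at least 1 at the bottom block and grows by at least 1 with each block above
    it. *)
Lemma size_le_u st t a : inT T t -> uniq (a :: st) -> all (inB B) (a :: st) ->
  (forall i j, inB B i -> inB B j -> adj B (a :: st) i j -> vu v j t + 1 <= vu v i t) ->
  (size (a :: st))%:R <= vu v a t.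
Proof.
move=> tT; elim: st a => [|b st IH] a; first by move=> _ /andP[aB _] _; have /andP[] := u1H aB tT.
move=> /andP[_ ubst] /andP[aB bstB] step.
have IHb : (size (b :: st))%:R <= vu v b t.
  apply: IH => // i j iB jB ij; apply: step => //.
  by rewrite -[adj _ _ _ _]/(_ || adj B (b :: st) i j) ij orbT.
have /andP[bB _] := bstB.
have := step a b aB bB; rewrite /= !eqxx => /(_ isT) ab.
by apply: le_trans ab; rewrite -[_.+2%:R]natr1 lerD2r.
Qed.

(** In a turn with a relocation, [yhat] and [ycheck] are each a single unit entry, both in the row
    of the moved block. *)
Lemma point_rows (F : nat -> nat -> R) i0 :
  (forall i j, inB B i -> inB' B j -> j != i -> binary (F i j)) -> inB B i0 ->
  \sum_(1 <= j < B.+2 | j != i0) F i0 j = 1 ->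
  (forall i, inB B i -> i != i0 -> \sum_(1 <= j < B.+2 | j != i) F i j = 0) ->
  exists j0, [/\ inB' B j0, j0 != i0 & forall i j, inB B i -> inB' B j -> j != i ->
    F i j = ((i == i0) && (j == j0))%:R].
Proof.
move=> Fbin i0B row1 row0; have [||j0 [j0B j0i Fj0 Fj]] := natural_sum1 _ _ row1.
- exact: iota_uniq.
- by move=> j; rewrite mem_B' => jB ji; apply/binary_natural/Fbin.
exists j0; rewrite -mem_B'; split=> // i j iB jB ji.
have [ii0|ii0] := eqVneq i i0; last first.
  apply: (nonneg_sum0 (r := index_iota 1 B.+2) (P := fun j => j != i) (F := F i)) => //.
  - by move=> k; rewrite mem_B' => kB ki; apply/binary_ge0/Fbin.
  - by rewrite row0.
  - by rewrite mem_B'.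
move: ji; rewrite ii0 => ji; have [-> //|jj0] := eqVneq j j0.
by rewrite Fj // mem_B'.
Qed.

Lemma reloc_phase c t : inT T t -> wf B c -> matches c t.-1 ->
  exists o, [/\ legal_seq H c (reloc_moves o), (isSome o)%:R = lift_total t,
    forall i j, inB B i -> inB' B j -> j != i ->
      yhat v i j t = (occurs (lifts B i j) c (reloc_moves o))%:R &
    forall i j, inB B i -> inB' B j -> j != i ->
      ycheck v i j t = (occurs (puts B i j) c (reloc_moves o))%:R].
Proof.
move=> tT cwf cx; have yhat_bin i j iB jB ji := cons_yhat5 com (i := i) (j := j) iB jB ji tT.
have ycheck_bin i j iB jB ji := cons_ycheck6 com (i := i) (j := j) iB jB ji tT.
have row_nat i iB := @yhat_row_natural i t iB tT.
have [tot0|tot1] := lift_total_binary tT.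
  exists None; have row0 i : inB B i -> \sum_(1 <= j < B.+2 | j != i) yhat v i j t = 0.
    move=> iB; apply: (nonneg_sum0 (r := index_iota 1 B.+1) (P := xpredT)
      (F := fun i => \sum_(1 <= j < B.+2 | j != i) yhat v i j t)) => //.
    - by move=> k; rewrite mem_B => kB _; apply/natural_ge0/row_nat.
    - by rewrite -[X in X <= _]/(lift_total t) tot0.
    - by rewrite mem_B.
  split=> // i j iB jB ji.
    apply: (nonneg_sum0 (r := index_iota 1 B.+2) (P := fun j => j != i)
      (F := fun j => yhat v i j t)) => //.
    - by move=> k; rewrite mem_B' => kB ki; apply/binary_ge0/yhat_bin.
    - by rewrite row0.
    - by rewrite mem_B'.
  apply: (nonneg_sum0 (r := index_iota 1 B.+2) (P := fun j => j != i)
    (F := fun j => ycheck v i j t)) => //.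
  - by move=> k; rewrite mem_B' => kB ki; apply/binary_ge0/ycheck_bin.
  - by rewrite (cons_ycheck1 com) // row0.
  - by rewrite mem_B'.
have [||i0 [i0B _ row1 row0]] := natural_sum1 _ _ tot1; first exact: iota_uniq.
  by move=> i; rewrite mem_B => iB _; apply: row_nat.
rewrite mem_B in i0B.
have {}row0 i : inB B i -> i != i0 -> \sum_(1 <= j < B.+2 | j != i) yhat v i j t = 0.
  by move=> iB; apply: row0 => //; rewrite mem_B.
have [j0 [j0B j0i yhatE]] := point_rows yhat_bin i0B row1 row0.
have [||j1 [j1B j1i ycheckE]] := point_rows ycheck_bin i0B.
- by rewrite (cons_ycheck1 com).
- by move=> i iB ii0; rewrite (cons_ycheck1 com) // row0.
have B_B' i : inB B i -> inB' B i by rewrite /inB /inB'; lia.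
have yhat_col k : inB B k -> \sum_(1 <= i < B.+1 | i != k) yhat v i k t = (k == j0)%:R.
  move=> kB; rewrite -(sum_col_point R k i0B j0i); apply: eq_sum_col => i iB ik.
  by rewrite yhatE ?B_B' // eq_sym.
have ycheck_col k : inB B k -> \sum_(1 <= i < B.+1 | i != k) ycheck v i k t = (k == j1)%:R.
  move=> kB; rewrite -(sum_col_point R k i0B j1i); apply: eq_sum_col => i iB ik.
  by rewrite ycheckE ?B_B' // eq_sym.
have floorB i : inB B i -> inB' B B.+1 && (B.+1 != i) by rewrite /inB /inB'; lia.
have yhat_floor : \sum_(1 <= i < B.+1) yhat v i B.+1 t = (B.+1 == j0)%:R.
  rewrite -(sum_floor_point R j0 i0B); apply: eq_sum_col => i iB _.
  by have /andP[h1 h2] := floorB i iB; rewrite yhatE.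
have ycheck_floor : \sum_(1 <= i < B.+1) ycheck v i B.+1 t = (B.+1 == j1)%:R.
  rewrite -(sum_floor_point R j1 i0B); apply: eq_sum_col => i iB _.
  by have /andP[h1 h2] := floorB i iB; rewrite ycheckE.
have in_or_floor j : inB' B j -> inB B j \/ B.+1 = j.
  by rewrite /inB /inB' => jB; have [->|] := eqVneq B.+1 j; [right|left; lia].
(* The right-hand side of (yhat4) is the indicator that [i0] is topmost. *)
have top_i0 : topmost c i0.
  have := cons_yhat4 com i0B tT; rewrite row1 (matches_row cwf cx) // (matches_col cwf cx) //.
  by case: (topmost c i0) => //=; lra.
have j01 : j0 != j1.
  apply/negP => /eqP j01; have [jB|jF] := in_or_floor _ j1B.
    have := cons_ycheck2 com jB tT.
    rewrite ycheck_col // yhat_col // (matches_row cwf cx) // j01 eqxx.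
    by case: (present c j1) => /=; lra.
  by have := cons_ycheck3 com tT; rewrite ycheck_floor yhat_floor j01 jF eqxx /=; lra.
(* No put-down compensates the lift at (i0,j0), and a retrieval could only lower the entry further.
   Nonnegativity of x at the end of the turn thus forces it to be 1 before. *)
have on_j0 : lies_on B c i0 j0.
  have tT1 : (t <= T)%N by case/andP: tT.
  have /andP[x_ge0 _] := x01 i0B j0B j0i tT1.
  have := x_ge0; have [lt|lt|e] := ltngtP i0 j0; last by rewrite e eqxx in j0i.
    rewrite (cons_x3 com) // yhatE // ycheckE // cx // !eqxx (negPf j01) /=.
    have := binary_ge0 (cons_z4 com i0B j0B lt tT).
    by case: lies_on => //=; lra.
  rewrite (cons_x2 com) // yhatE // ycheckE // cx // !eqxx (negPf j01) /=.
  by case: lies_on => //=; lra.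
have [s /eqP cs0] := existsP top_i0.
have [st cs] : exists st, c s = i0 :: st by case: (c s) cs0 => //= a st [->]; exists st.
have j0E : j0 = below B st by apply/eqP; rewrite -(lies_on_top _ cwf cs).
(* If [j1] is a block, (ycheck4) makes it topmost, and [j1 != i0] separates its stack from the
   source. If [j1] is the floor, (ycheck5) leaves an empty stack. *)
have [d sd j1E] : exists2 d, s != d & j1 = below B (c d).
  have [jB|jF] := in_or_floor _ j1B.
    have : topmost c j1.
      have := cons_ycheck4 com jB tT.
      rewrite ycheck_col // (matches_row cwf cx) // (matches_col cwf cx) // eqxx.
      by case: (topmost c j1) => //=; lra.
    case/existsP => d /eqP cd; exists d; last by case: (c d) cd => //= a st' [].
    apply: contra j1i => /eqP sd; move: cd; rewrite -sd cs => -[->]; exact: eqxx.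
  have [d cd] : exists d, c d = [::].
    have := cons_ycheck5 com tT; rewrite ycheck_floor (matches_floor cwf cx) jF eqxx.
    have [/existsP[d /eqP cd] _|none] := boolP [exists d, c d == [::]]; first by exists d.
    rewrite (eq_bigr (fun _ => 1)); first by rewrite sumr_const card_ord subrr ler10.
    by move=> d _; move: none; rewrite negb_exists => /forallP/(_ d) ->.
  exists d; last by rewrite cd.
  by apply/eqP => sd; move: cs; rewrite sd cd.
have lifts_o i j : occurs (lifts B i j) c (reloc_moves (Some (s, d))) = (i == i0) && (j == j0).
  by rewrite /reloc_moves occurs_cons orbF (lifts_top _ d i j cs) j0E.
have puts_o i j : occurs (puts B i j) c (reloc_moves (Some (s, d))) = (i == i0) && (j == j1).
  by rewrite /reloc_moves occurs_cons orbF (puts_top _ d i j cs) j1E.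
exists (Some (s, d)); rewrite tot1; split=> //; last first.
- by move=> i j iB jB ji; rewrite puts_o ycheckE.
- by move=> i j iB jB ji; rewrite lifts_o yhatE.
rewrite /= andbT sd cs /=.
(* Height limit: for adjacent blocks of the new destination stack the factor of [H] in (u1) is 0, so
   u increases upwards, and its value at the top is at most [H]. *)
have wwf := wf_reloc cwf cs sd; have wd : next c (Reloc s d) d = i0 :: c d.
  by rewrite (relocE d cs) ffunE eq_sym (negPf sd) eqxx.
have := wf_uniq wwf d; have := wf_range wwf d; rewrite wd => allB uniqd.
rewrite -(ler_nat R); have /andP[_ uH] := u1H i0B tT; apply: le_trans uH.
apply: (size_le_u tT uniqd allB) => i j iB jB ij.
have ji := adj_neq uniqd allB ij.
have := cons_u1 com iB jB ji tT; rewrite cx ?B_B' // yhatE ?B_B' // ycheckE ?B_B' //.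
have : lies_on B (next c (Reloc s d)) i j.
  by rewrite lies_on_adj; apply/existsP; exists d; rewrite wd.
have := natr_lies_on_reloc R i j cwf cs sd; rewrite -j0E -j1E => + h; rewrite h => e.
have -> : 1 - (lies_on B c i j)%:R + ((i == i0) && (j == j0))%:R
    - ((i == i0) && (j == j1))%:R = 0 :> R.
  by rewrite /= in e; lra.
by rewrite mulr0 subr0.
Qed.


(** After the relocation, the labels present before and after the turn form two final segments,
    above [r] and above [r']. Row sums show that exactly the blocks in between are retrieved, and
    [retrieval_phase] realises this. *)
Lemma turn_step c t : inT T t -> wf B c -> matches c t.-1 ->
  exists tr : turn S, [/\ legal_seq H c (turn_moves tr), (isSome tr.1)%:R = lift_total t,
    matches (exec c (turn_moves tr)) t &
    [/\ forall i j, inB B i -> inB' B j -> j != i ->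
      yhat v i j t = (occurs (lifts B i j) c (turn_moves tr))%:R,
    forall i j, inB B i -> inB' B j -> j != i ->
      ycheck v i j t = (occurs (puts B i j) c (turn_moves tr))%:R &
    forall i j, inB B i -> inB' B j -> (i < j)%N ->
      vz v i j t = (occurs (retrieves B i j) c (turn_moves tr))%:R]].
Proof.
move=> tT cwf cx; have [o [lego lift_o yhat_o ycheck_o]] := reloc_phase tT cwf cx.
have tT1 : (t <= T)%N by case/andP: tT.
have tT0 : (t.-1 <= T)%N by lia.
have row_step i iB := x_row_step (cons_x2 com) (cons_x3 com) (cons_ycheck1 com) (i := i) iB tT.
set w := exec c (reloc_moves o).
have wwf : wf B w by apply: wf_exec lego.
have won i j : inB B i -> inB' B j -> j != i ->
    (lies_on B w i j)%:R = vx v i j t.-1 - yhat v i j t + ycheck v i j t.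
  by move=> iB jB ji; rewrite yhat_o // ycheck_o // cx // (natr_lies_on_mid R i j cwf lego).
have wrow i : inB B i -> \sum_(1 <= j < B.+2 | j != i) vx v i j t.-1 = (present w i)%:R.
  move=> iB; rewrite -(sum_lies_on_row R i wwf) (eq_sum_row (won i ^~ iB)).
  by rewrite big_split sumrB /= (cons_ycheck1 com) // subrK.
have z_bin i j iB jB ij := cons_z4 com (i := i) (j := j) iB jB ij tT.
(* Although x may be fractional a priori, its row sum is a presence indicator minus a natural
   number, and it is nonnegative. *)
have row_bin i : inB B i -> binary (\sum_(1 <= j < B.+2 | j != i) vx v i j t).
  move=> iB; have ge0 : 0 <= \sum_(1 <= j < B.+2 | j != i) vx v i j t.
    rewrite big_nat_cond; apply: sumr_ge0 => j /andP[jB ji].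
    by have /andP[] := x01 iB jB ji tT1.
  have [n zn] : natural (\sum_(1 <= j < B.+2 | (i < j)%N) vz v i j t).
    by apply: natural_sum => j; rewrite mem_B' => jB ij; apply/binary_natural/z_bin.
  move: ge0; rewrite row_step // wrow // zn subr_ge0 ler_nat.
  by case: (present w i) => /=; case: n {zn} => [|[|n]] // _;
    rewrite ?subr0 ?subrr; [right|left|left].
have [|r rB rP] := @threshold B (present w).
  move=> i iB; have iB1 : inB B i by rewrite /inB; lia.
  have iB2 : inB B i.+1 by rewrite /inB; lia.
  have := x_row_mono iB1 iB2 tT0; rewrite !wrow //.
  by case: (present w i); case: (present w i.+1); rewrite //= ler10.
have [|r' r'B r'P] := @threshold B (fun i => \sum_(1 <= j < B.+2 | j != i) vx v i j t == 1).
  move=> i iB; have iB1 : inB B i by rewrite /inB; lia.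
  have iB2 : inB B i.+1 by rewrite /inB; lia.
  have := x_row_mono iB1 iB2 tT1 => + /eqP e; rewrite e.
  by case: (row_bin _ iB2) => ->; rewrite ?eqxx // ler10.
have row' i : inB B i -> \sum_(1 <= j < B.+2 | j != i) vx v i j t = (r' < i)%:R.
  move=> iB; rewrite -r'P //; case: (row_bin i iB) => ->; rewrite ?eqxx //.
  by rewrite eq_sym oner_eq0.
have zrow i : inB B i ->
    \sum_(1 <= j < B.+2 | (i < j)%N) vz v i j t = (r < i)%:R - (r' < i)%:R.
  by move=> iB; have := row_step i iB; rewrite row' // wrow // rP //; lra.
have zrow0 i : inB B i -> 0 <= \sum_(1 <= j < B.+2 | (i < j)%N) vz v i j t.
  move=> iB; rewrite big_nat_cond; apply: sumr_ge0 => j /andP[jB ij].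
  exact/binary_ge0/z_bin.
have rr' : (r <= r')%N.
  rewrite leqNgt; apply/negP => r'r; have iB : inB B r'.+1 by rewrite /inB; lia.
  have := zrow0 _ iB; rewrite zrow // ltnSn.
  have -> : (r < r'.+1)%N = false by lia.
  by rewrite /= sub0r oppr_ge0 ler10.
(* In the last turn this is (x4). Earlier, row [i] sums to 0, so (yhat4) for turn t+1 bounds the
   nonnegative column sum of [i] by 0. *)
have xt0 k i : inB B k -> inB B i -> (i < k)%N -> (i <= r')%N -> vx v k i t = 0.
  move=> kB iB ik ir'; have [tlt|tge] := ltnP t T; last first.
    have -> : t = T by lia.
    by apply: (cons_x4 com); move: kB iB ik; rewrite /inB /inB'; lia.
  have tT' : inT T t.+1 by rewrite /inT; lia.
  have := cons_yhat4 com iB tT'; rewrite /= row' // ltnNge ir' /= sub0r => le.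
  apply: (nonneg_sum0 (r := index_iota 1 B.+1) (P := fun j => j != i) (F := fun j => vx v j i t)).
  - move=> j; rewrite mem_B => jB ji; have iB' : inB' B i by move: iB; rewrite /inB /inB'; lia.
    by have /andP[] := x01 jB iB' (ltac:(by rewrite eq_sym) : i != j) tT1.
  - rewrite -oppr_ge0; apply: le_trans le; exact/natural_ge0/yhat_row_natural.
  - by rewrite mem_B.
  - by rewrite gtn_eqF.
have B_B' i : inB B i -> inB' B i by rewrite /inB /inB'; lia.
have [|||||rs legrs rsZ] := @retrieval_phase B S H w (fun i j => vz v i j t == 1) r r' wwf.
- by rewrite rr'.
- by move=> i iB; rewrite rP.
- move=> i j iB jB ij /eqP zij; have ji : j != i by rewrite gtn_eqF.
  apply/andP; split.
    have /andP[+ _] := x01 iB jB ji tT1; rewrite (cons_x3 com) // -won // zij.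
    by case: lies_on => //=; lra.
  have : (r < i)%:R - (r' < i)%:R != 0 :> R.
    rewrite -zrow //; apply/negP => /eqP z0.
    suff : vz v i j t = 0 by rewrite zij => /eqP; rewrite oner_eq0.
    apply: (nonneg_sum0 (r := index_iota 1 B.+2) (P := fun j => (i < j)%N)
      (F := fun j => vz v i j t)) => //; last by rewrite mem_B'.
    - by move=> k; rewrite mem_B' => kB ik; apply/binary_ge0/z_bin.
    - by rewrite z0.
  have [ri|ri] := ltnP r i; have [r'i|r'i] := ltnP r' i; rewrite ?subrr ?eqxx //; lia.
- move=> i ri; have iB : inB B i by rewrite /inB; lia.
  have z1 : \sum_(1 <= j < B.+2 | (i < j)%N) vz v i j t = 1.
    by case/andP: ri => ri ir'; rewrite zrow // ri ltnNge ir' subr0.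
  have [||j [jB ij zj _]] := natural_sum1 _ _ z1; first exact: iota_uniq.
    by move=> j; rewrite mem_B' => jB ij; apply/binary_natural/z_bin.
  by exists j; rewrite -mem_B' zj eqxx.
- move=> k i kB iB ik ir'; have := xt0 k i kB iB ik ir'.
  rewrite (cons_x2 com) ?B_B' // -won ?B_B' //; last by rewrite ltn_eqF.
  by case: lies_on => // /eqP; rewrite oner_eq0.
have z_rs i j : inB B i -> inB' B j -> (i < j)%N ->
    vz v i j t = (occurs (retrieves B i j) c (turn_moves (o, rs)))%:R.
  move=> iB jB ij; rewrite turn_retrieves rsZ //.
  by case: (z_bin i j iB jB ij) => ->; rewrite ?eqxx // eq_sym oner_eq0.
have leg : legal_seq H c (turn_moves (o, rs)) by rewrite legal_seq_cat lego.
exists (o, rs); split=> //; last first.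
  by split=> // i j iB jB ji; rewrite ?turn_lifts ?turn_puts ?yhat_o ?ycheck_o.
move=> i j iB jB ji; rewrite (natr_lies_on_turn R i j cwf leg).
rewrite -cx // turn_lifts turn_puts -yhat_o // -ycheck_o //.
(* For i < j the balance is (x3); for j < i it is (x2), and no retrieval of [i] from [j] occurs. *)
have [ij|ij|e] := ltngtP i j; last by rewrite e eqxx in ji.
  by rewrite (cons_x3 com) // -z_rs.
by rewrite (cons_x2 com) // turn_retrieves (occurs_retrieves_lt wwf legrs) // subr0.
Qed.

Definition stage (trs : seq (turn S)) t : config S :=
  exec c0 (flatten (map (@turn_moves S) (take t trs))).

Definition no_turn : turn S := (None, [::]).

Definition turn_matches trs t : Prop :=
  let ms := turn_moves (nth no_turn trs t.-1) in
  [/\ forall i j, inB B i -> inB' B j -> j != i ->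
      yhat v i j t = (occurs (lifts B i j) (stage trs t.-1) ms)%:R,
    forall i j, inB B i -> inB' B j -> j != i ->
      ycheck v i j t = (occurs (puts B i j) (stage trs t.-1) ms)%:R &
    forall i j, inB B i -> inB' B j -> (i < j)%N ->
      vz v i j t = (occurs (retrieves B i j) (stage trs t.-1) ms)%:R].

Lemma decode_turns n : (n <= T)%N -> exists trs : seq (turn S),
  [/\ size trs = n, legal_seq H c0 (flatten (map (@turn_moves S) trs)),
    forall t, (t <= n)%N -> matches (stage trs t) t &
    forall t, (1 <= t <= n)%N ->
      (isSome (nth no_turn trs t.-1).1)%:R = lift_total t /\ turn_matches trs t].
Proof.
elim: n => [_|n IH nT].
  exists [::]; split=> // t; last by lia.
  by rewrite leqn0 => /eqP-> i j iB jB ji; rewrite (cons_x1 com).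
have [trs [szn leg mat turns]] := IH (ltnW nT).
set c := exec c0 (flatten (map (@turn_moves S) trs)).
have stage_n : stage trs n = c by rewrite /stage take_oversize // szn.
have cwf : wf B c by apply: wf_exec leg.
have nT' : inT T n.+1 by rewrite /inT.
have [|tr [legtr lift_tr mattr [yh yc z]]] := @turn_step c n.+1 nT' cwf.
  by rewrite -stage_n; apply: mat.
have stage_le t : (t <= n)%N -> stage (rcons trs tr) t = stage trs t.
  by move=> tn; rewrite /stage -cats1 takel_cat // szn.
have stage_tr : stage (rcons trs tr) n.+1 = exec c (turn_moves tr).
  rewrite /stage take_oversize ?size_rcons ?szn // map_rcons -cats1 flatten_cat /= cats0.
  by rewrite exec_cat.
exists (rcons trs tr); split; first by rewrite size_rcons szn.
- by rewrite map_rcons -cats1 flatten_cat /= cats0 legal_seq_cat leg.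
- move=> t; rewrite leq_eqVlt ltnS => /orP[/eqP->|tn]; first by rewrite stage_tr.
  by rewrite stage_le //; apply: mat.
move=> t tn; rewrite /turn_matches nth_rcons szn.
have [->|tne] := eqVneq t n.+1.
  by rewrite /= ltnn eqxx stage_le // stage_n.
have -> : (t.-1 < n)%N by lia.
by rewrite stage_le; [apply: turns; lia|lia].
Qed.

Lemma nreloc_flatten (trs : seq (turn S)) :
  nreloc (flatten (map (@turn_moves S) trs))
  = (\sum_(1 <= t < (size trs).+1) isSome (nth no_turn trs t.-1).1)%N.
Proof.
elim/last_ind: trs => [|trs tr IH]; first by rewrite big_geq.
rewrite map_rcons -cats1 flatten_cat /= cats0 /nreloc count_cat -/(nreloc _) IH size_rcons.
rewrite [RHS]big_nat_recr //= nth_rcons ltnn eqxx -/(nreloc _) nreloc_turn; congr (_ + _)%N.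
apply: eq_big_nat => t tn; rewrite nth_rcons.
by have -> : (t.-1 < size trs)%N by lia.
Qed.

(** By (ycheck1), put-downs and lifts are equally many in each turn. *)
Lemma objectiveE : objective B T v = \sum_(1 <= t < T.+1) lift_total t.
Proof.
rewrite /objective; under eq_bigr do rewrite exchange_big /=.
rewrite exchange_big /=; apply: eq_big_nat => t tT.
by apply: eq_big_nat => i iB; apply: (cons_ycheck1 com).
Qed.

Lemma decoding : exists ms,
  [/\ solves H c0 ms, (nreloc ms)%:R = objective B T v & encodes B T c0 v ms].
Proof.
have [trs [szT leg mat turns]] := decode_turns (leqnn T).
set ms := flatten (map (@turn_moves S) trs) in leg.
pose relocates t := isSome (nth no_turn trs t.-1).1.
(* A turn without relocation is followed only by such turns, by (yhat1) and (yhat2). Hence the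
   relocations fill the first [r] turns, as [turns_of] requires. *)
have [|r rT rP] := @threshold T (fun t => ~~ relocates t).
  move=> t tT; apply: contra => t1; have tT1 : inT T t by rewrite /inT; lia.
  have tT2 : inT T t.+1 by rewrite /inT; lia.
  have rt : (relocates t)%:R = lift_total t by have [] := turns t tT1.
  have rt1 : 1%:R = lift_total t.+1.
    by have [<- _] := turns t.+1 tT2; rewrite -[isSome _]/(relocates t.+1) t1.
  have [tL|tL] := leqP t.+1 L.
    move: rt; rewrite [lift_total t](cons_yhat1 com) //; last by lia.
    by case: (relocates t) => // /eqP; rewrite eq_sym oner_eq0.
  have : lift_total t.+1 <= lift_total t := cons_yhat2 com tT2 tL; rewrite -rt -rt1.
  by case: (relocates t) => //=; rewrite ler10.
have nr : nreloc ms = r.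
  rewrite nreloc_flatten szT -[RHS](sum_leq_nat rT); apply: eq_big_nat => t tT.
  by rewrite -/(relocates t) -[relocates t]negbK rP // -leqNgt.
exists ms; split.
(* The top block of a nonempty final stack would give a nonzero entry of x at turn [T], against
   (x4). *)
- rewrite /solves leg; apply/eqP/ffunP => s; rewrite ffunE.
  have := mat T (leqnn T); rewrite /stage take_oversize ?szT // -/ms => matT.
  have wT : wf B (exec c0 ms) by apply: wf_exec leg.
  case es: (exec c0 ms s) => [//|a st]; have [aB stB] := wf_top_range wT es.
  have := matT a (below B st) aB (below_range stB) (below_neq aB (wf_top_notin wT es)).
  rewrite (lies_on_top _ wT es) eqxx (cons_x4 com) ?below_range ?below_neq ?(wf_top_notin wT es) //.
  by move/eqP; rewrite eq_sym oner_eq0.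
- rewrite objectiveE nreloc_flatten szT natr_sum; apply: eq_big_nat => t tT.
  by have [] := turns t tT.
exists (map (@turn_moves S) trs); split.
  split=> [||t tT]; rewrite ?size_map //.
  exists (size (nth no_turn trs t.-1).2).
  rewrite (nth_map no_turn); last by move: tT; rewrite szT /inT; lia.
  rewrite is_reloc_turn nr; congr (nseq (nat_of_bool _) _ ++ _).
  by rewrite -/(relocates t) -[relocates t]negbK rP // -leqNgt.
have nthE t : inT T t ->
    nth [::] (map (@turn_moves S) trs) t.-1 = turn_moves (nth no_turn trs t.-1).
  by move=> tT; rewrite (nth_map no_turn) //; move: tT; rewrite szT /inT; lia.
split=> i j t iB jB ij tT; rewrite -map_take -/(stage trs _) ?nthE //; first exact: mat.
all: by have [_ []] := turns t tT; auto.
Qed.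

End Decoding.

(** * Optimal sequences that retrieve block 1 at once *)

Section Surgery.
Variables (B S H : nat).
Implicit Types (c : config S) (s d : 'I_S) (ms : seq (move S)).

Lemma solves_cons c mv ms : solves H c (mv :: ms) = legal H c mv && solves H (next c mv) ms.
Proof. by rewrite /solves /= andbA. Qed.

Lemma solves_cat c ms ms' :
  solves H c (ms ++ ms') = legal_seq H c ms && solves H (exec c ms) ms'.
Proof. by rewrite /solves legal_seq_cat exec_cat andbA. Qed.

Lemma nreloc_cat ms ms' : nreloc (ms ++ ms') = (nreloc ms + nreloc ms')%N.
Proof. exact: count_cat. Qed.

Definition remove_block b c : config S := [ffun k => filter (predC1 b) (c k)].

(** The moves of [b] are dropped. The others stay legal, since stacks only become lower and a
    smallest label remains smallest. *)
Lemma solves_remove_block b c ms : solves H c ms ->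
  exists2 ms', solves H (remove_block b c) ms' & (nreloc ms' <= nreloc ms)%N.
Proof.
elim: ms c => [|mv ms IH] c.
  move=> /andP[_ /eqP ce]; exists [::] => //; rewrite /solves /=; apply/eqP/ffunP => k.
  by rewrite !ffunE [c]ce ffunE.
rewrite solves_cons => /andP[leg /IH[ms' sol' le']]; case: mv leg sol' le' => [s d|s] leg sol' le'.
  have [a [st [cs sd dH]]] := legal_relocP leg; have ds : d != s by rewrite eq_sym.
  have [ab|ab] := eqVneq a b.
    exists ms'; last by rewrite (leq_trans le') // leq_addl.
    congr (solves _ _ _): sol'; apply/ffunP => k; rewrite (relocE d cs) !ffunE.
    by case: eqP => [->|_]; [rewrite cs|case: eqP => [->|//]]; rewrite /= ab eqxx.
  exists (Reloc s d :: ms'); last by rewrite /nreloc /= leq_add2l.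
  have rs : remove_block b c s = a :: filter (predC1 b) st by rewrite ffunE cs /= ab.
  rewrite solves_cons; apply/andP; split.
    rewrite /= sd rs /= ffunE size_filter.
    by apply: leq_ltn_trans dH; apply: count_size.
  congr (solves _ _ _): sol'; apply/ffunP => k; rewrite (relocE d cs) (relocE d rs) !ffunE.
  by case: eqP => // _; case: eqP => // _; rewrite /= ab.
have [a [st [cs amin]]] := legal_retrP leg.
have [ab|ab] := eqVneq a b.
  exists ms' => //.
  congr (solves _ _ _): sol'; apply/ffunP => k; rewrite (retrE cs) !ffunE.
  by case: eqP => [->|_] //; rewrite cs /= ab eqxx.
exists (Retr s :: ms') => //.
have rs : remove_block b c s = a :: filter (predC1 b) st by rewrite ffunE cs /= ab.
rewrite solves_cons; apply/andP; split.
  rewrite /= rs; apply/forallP => k; apply/allP => x; rewrite ffunE mem_filter => /andP[_].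
  exact: amin.
congr (solves _ _ _): sol'; apply/ffunP => k; rewrite (retrE cs) (retrE rs) !ffunE.
by case: eqP.
Qed.

Lemma remove_top c s b st : wf B c -> c s = b :: st -> remove_block b c = next c (Retr s).
Proof.
move=> cwf cs; apply/ffunP => k; rewrite (retrE cs) !ffunE; case: eqP => [->|ks].
  rewrite cs /= eqxx; apply/all_filterP/allP => x xst /=.
  by apply: contraTneq xst => ->; exact: wf_top_notin cwf cs.
apply/all_filterP/allP => x xk /=; apply: contra_notN ks => /eqP xb.
by apply: (wf_disj cwf xk); rewrite xb cs mem_head.
Qed.

Definition permute_stacks (p : {perm 'I_S}) c : config S := [ffun k => c (p k)].

(** Stack [k] of the new configuration is stack [p k] of the old one, so the moves are renamed by
    the inverse of [p]. *)
Lemma solves_permute (p : {perm 'I_S}) c ms : solves H c ms ->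
  exists2 ms', solves H (permute_stacks p c) ms' & nreloc ms' = nreloc ms.
Proof.
have permE k s : (k == (p^-1)%g s) = (p k == s) by rewrite -(inj_eq (@perm_inj _ p)) permKV.
elim: ms c => [|mv ms IH] c.
  move=> /andP[_ /eqP ce]; exists [::] => //; rewrite /solves /=; apply/eqP/ffunP => k.
  by rewrite !ffunE [c]ce ffunE.
rewrite solves_cons => /andP[leg /IH[ms' sol' le']]; case: mv leg sol' => [s d|s] leg sol'.
  have [a [st [cs sd dH]]] := legal_relocP leg.
  have ps : permute_stacks p c ((p^-1)%g s) = a :: st by rewrite ffunE permKV.
  exists (Reloc ((p^-1)%g s) ((p^-1)%g d) :: ms'); last by rewrite /nreloc /= -!/(nreloc _) le'.
  rewrite solves_cons; apply/andP; split.
    by rewrite /= (inj_eq perm_inj) sd ps /= ffunE permKV.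
  congr (solves _ _ _): sol'; apply/ffunP => k.
  by rewrite (relocE d cs) (relocE _ ps) !ffunE !permE permKV.
have [a [st [cs amin]]] := legal_retrP leg.
have ps : permute_stacks p c ((p^-1)%g s) = a :: st by rewrite ffunE permKV.
exists (Retr ((p^-1)%g s) :: ms') => //; rewrite solves_cons; apply/andP; split.
  by rewrite /= ps; apply/forallP => k; apply/allP => x; rewrite ffunE; apply: amin.
congr (solves _ _ _): sol'; apply/ffunP => k.
by rewrite (retrE cs) (retrE ps) !ffunE permE.
Qed.

Lemma below_floor c s : wf B c -> below B (c s) = B.+1 -> c s = [::].
Proof. by move/wf_range => /(_ s); case: (c s) => //= b st /andP[+ _] e; rewrite e /inB; lia. Qed.

(* Moving a lone block onto an empty stack only permutes the stacks. *)
Lemma min_no_floor_to_floor c0 m pre s d post : wf B c0 ->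
  (forall ms, solves H c0 ms -> (m <= nreloc ms)%N) ->
  solves H c0 (pre ++ Reloc s d :: post) -> nreloc (pre ++ Reloc s d :: post) = m ->
  ~~ ((below B (behead (exec c0 pre s)) == B.+1) && (below B (exec c0 pre d) == B.+1)).
Proof.
move=> c0wf mmin; rewrite solves_cat => /andP[legpre]; rewrite solves_cons => /andP[leg sol] nm.
set c := exec c0 pre in leg sol *; have cwf : wf B c by apply: wf_exec legpre.
apply/negP => /andP[/eqP bs /eqP bd].
have [a [st [cs sd dH]]] := legal_relocP leg.
have cd : c d = [::] by apply: below_floor.
have st0 : st = [::].
  case: st cs bs => //= b st cs; rewrite cs /= => be.
  by have [_ /andP[]] := wf_top_range cwf cs; rewrite be /inB; lia.
(* Dropping the relocation and exchanging the roles of [s] and [d] afterwards saves one relocation,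
   against minimality. *)
have [ms' sol' n'] := solves_permute (tperm s d) sol.
have : solves H c0 (pre ++ ms').
  rewrite solves_cat legpre; congr (solves _ _ _): sol'.
  apply/ffunP => k; rewrite (relocE d cs) !ffunE; case: tpermP => [->|->|].
  - by rewrite eq_sym (negPf sd) eqxx cd cs st0.
  - by rewrite eqxx cd st0.
  - by move=> /eqP/negPf-> /eqP/negPf->.
by move/mmin; move: nm; rewrite !nreloc_cat n' /nreloc /=; lia.
Qed.

(** While [jb] covers block 1 nothing can be retrieved, so [ms] starts with relocations. [pre] runs
    up to the one that takes [jb] away; block 1 is then retrieved, and [post] comes from erasing
    block 1 from the rest of [ms]. *)
Lemma eager_split c s0 jb p a ms : wf B c -> c s0 = a ++ jb :: 1%N :: p -> solves H c ms ->
  exists pre post, [/\ all (@is_reloc S) pre, legal_seq H c pre,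
    forall k, (k < size pre)%N -> exists a', exec c (take k pre) s0 = a' ++ jb :: 1%N :: p,
    exec c pre s0 = 1%N :: p &
    solves H (next (exec c pre) (Retr s0)) post /\ (nreloc pre + nreloc post <= nreloc ms)%N].
Proof.
elim: ms c a => [|mv ms IH] c a cwf cs0.
  by move=> /andP[_ /eqP ce]; move: cs0; rewrite [c]ce ffunE; case: a.
rewrite solves_cons => /andP[]; case: mv => [s d|s] leg sol; last first.
  have [b [st [cs bmin]]] := legal_retrP leg.
  have in1 : 1%N \in c s0 by rewrite cs0 mem_cat !inE eqxx !orbT.
  have b1 : b = 1%N by have := bmin _ _ in1; have [] := wf_top_range cwf cs; rewrite /inB; lia.
  have es : s = s0 by apply: (wf_disj cwf (b := 1%N)) => //; rewrite cs b1 mem_head.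
  have := wf_uniq cwf s0; rewrite cs0; move: cs; rewrite es cs0 b1.
  case: a {cs0} => [|x a] [-> _] /=; first by [].
  by rewrite mem_cat !inE eqxx !orbT.
have [b [st [cs sd dH]]] := legal_relocP leg.
have cwf' : wf B (next c (Reloc s d)) by apply: wf_reloc cs sd.
(* Either this relocation uncovers block 1, or it leaves [jb] on block 1 and everything beneath
   unchanged. *)
have [[es a0]|] : (s = s0 /\ a = [::]) \/ exists a', next c (Reloc s d) s0 = a' ++ jb :: 1%N :: p.
  rewrite (relocE d cs) ffunE; have [es|s0s] := eqVneq s0 s.
    case: a cs0 => [|x a] cs0; first by left.
    by right; exists a; move: cs; rewrite -es cs0 => -[].
  right; have [e|_] := eqVneq s0 d; last by exists a.
  by exists (b :: a); rewrite -e cs0.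
  have ns0 : next c (Reloc s d) s0 = 1%N :: p.
    by rewrite (relocE d cs) ffunE -es eqxx; move: cs; rewrite es cs0 a0 => -[].
  have [post solp le] := solves_remove_block 1 sol.
  exists [:: Reloc s d], post; split => //; first by apply/andP; split.
  - by case=> // _; exists a; rewrite cs0.
  split; last by rewrite /nreloc /= in le *; lia.
  by rewrite exec_cons -(remove_top cwf' ns0).
move=> [a' ns0]; have [pre [post [allp legp stp prep [solp le]]]] := IH _ _ cwf' ns0 sol.
exists (Reloc s d :: pre), post; split=> //; first by apply/andP; split.
- case=> [_|k kp]; first by exists a; rewrite cs0.
  by have [a'' e] := stp k kp; exists a''.
Qed.

(** The leading retrievals [rs] have no relocation before them in [ms]; they will be attached to the
    turn of the preceding relocation. *)
Lemma group_turns ms : exists (rs : seq 'I_S) (g : seq (turn S)),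
  ms = map (@Retr S) rs ++ flatten (map (@turn_moves S) g) /\ all (fun tr => isSome tr.1) g.
Proof.
elim: ms => [|[s d|s] ms [rs [g [-> allg]]]]; first by exists [::], [::].
  by exists [::], ((Some (s, d), rs) :: g).
by exists (s :: rs), g.
Qed.

Lemma absent_exec c b ms : ~~ present c b -> ~~ present (exec c ms) b.
Proof.
elim: ms c => // mv ms IH c cb; rewrite exec_cons; apply: IH; apply: contra cb => /existsP[k].
rewrite /present; case: mv => [s d|s]; rewrite ffunE.
  case: eqP => _ bk; first by apply/existsP; exists s; apply: mem_behead.
  move: bk; case: eqP => [_|_ bk]; last by apply/existsP; exists k.
  rewrite mem_cat => /orP[/mem_take bs|bd]; first by apply/existsP; exists s.
  by apply/existsP; exists d.
by case: eqP => _ bk; apply/existsP; [exists s; apply: mem_behead|exists k].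
Qed.

Lemma absent_remove c b : ~~ present (remove_block b c) b.
Proof.
by rewrite negb_exists; apply/forallP => k; rewrite ffunE mem_filter /= eqxx.
Qed.

Definition reloc_turn (mv : move S) : turn S :=
  if mv is Reloc s d then (Some (s, d), [::]) else no_turn S.

Lemma flatten_reloc_turn ms : all (@is_reloc S) ms ->
  flatten (map (@turn_moves S) (map reloc_turn ms)) = ms.
Proof. by elim: ms => // -[s d|//] ms IH /= /IH->. Qed.

Lemma eager_turns (T m : nat) c0 : wf B c0 -> present c0 1 -> block1_not_topmost c0 ->
  min_relocations H c0 m -> (m <= T)%N ->
  exists trs : seq (turn S),
    [/\ size trs = T, solves H c0 (flatten (map (@turn_moves S) trs)),
      forall t, inT T t -> isSome (nth (no_turn S) trs t.-1).1 = (t <= m)%N,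
      forall t s d, inT T t -> (nth (no_turn S) trs t.-1).1 = Some (s, d) ->
        ~~ ((below B (behead (stage c0 trs t.-1 s)) == B.+1)
            && (below B (stage c0 trs t.-1 d) == B.+1)) &
      exists s0 jb p t1, forall t,
        ((t < t1)%N -> exists a, stage c0 trs t s0 = a ++ jb :: 1%N :: p) /\
        ((t1 <= t)%N -> ~~ present (stage c0 trs t) 1)].
Proof.
move=> c0wf /existsP[s0 in1] top1 [[ms0 [sol0 nm0]] mmin] mT.
have [a [jb [p cs0]]] : exists a jb p, c0 s0 = a ++ jb :: 1%N :: p.
  have := top1 s0; case/splitPr: in1 => l p.
  case/lastP: l => [|a jb _]; first by [].
  by exists a, jb, p; rewrite cat_rcons.
have [pre [post [allp legp stp prep [solp len]]]] := eager_split c0wf cs0 sol0.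
have prewf : wf B (exec c0 pre) by apply: wf_exec legp.
have [rs [g [postE allg]]] := group_turns post.
have [pre' [mv preE]] : exists pre' mv, pre = rcons pre' mv.
  case/lastP: pre prep {allp legp stp solp len prewf} => [e|pre' mv _]; last by exists pre', mv.
  by have := top1 s0; rewrite [c0 s0]e.
have [s [d mvE]] : exists s d, mv = Reloc s d.
  by move: allp; rewrite preE all_rcons; case: (mv) => // s d _; exists s, d.
have allp' : all (@is_reloc S) pre' by move: allp; rewrite preE all_rcons => /andP[].
(* The turn that uncovers block 1 also retrieves it and takes in [rs]; every turn of [q] starts with
   a relocation. Empty turns then pad the list to length [T]. *)
pose q := map reloc_turn pre' ++ (Some (s, d), s0 :: rs) :: g.
pose trs := q ++ nseq (T - m) (no_turn S).
have flat_nseq n : flatten (map (@turn_moves S) (nseq n (no_turn S))) = [::] by elim: n.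
have flat_q : flatten (map (@turn_moves S) q) = pre ++ Retr s0 :: post.
  rewrite map_cat flatten_cat flatten_reloc_turn // preE mvE cat_rcons; congr (_ ++ _).
  by rewrite /= postE.
have flatE : flatten (map (@turn_moves S) trs) = pre ++ Retr s0 :: post.
  by rewrite map_cat flatten_cat flat_nseq cats0.
have sol : solves H c0 (pre ++ Retr s0 :: post).
  rewrite solves_cat legp solves_cons solp andbT /= prep.
  by apply/forallP => k; apply/allP => x /(wf_inB prewf); rewrite /inB => /andP[].
have allq : all (fun tr => isSome tr.1) q.
  by rewrite all_cat /= allg andbT all_map; apply: sub_all allp' => -[].
(* The surgery adds no relocation to an optimal sequence, so the result is optimal too. *)
have nm : nreloc (pre ++ Retr s0 :: post) = m.
  apply/eqP; rewrite eqn_leq mmin // andbT -nm0; move: len.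
  by rewrite nreloc_cat.
have sizeq : size q = m.
  rewrite -nm -flat_q; elim: (q) allq => //= tr q' IH /andP[tr1 /IH->].
  by rewrite nreloc_cat nreloc_turn tr1.
exists trs; split.
- by rewrite size_cat size_nseq sizeq subnKC.
- by rewrite flatE.
- move=> t /andP[t0 tT]; rewrite nth_cat sizeq; case: ltnP => tm.
    by have /(all_nthP (no_turn S))/(_ t.-1) := allq; rewrite sizeq => -> //; lia.
  by rewrite nth_nseq; case: ifP => _ /=; lia.
- move=> t s' d' /andP[t0 tT] trE; rewrite -flatE in sol nm.
  have szT : size trs = T by rewrite size_cat size_nseq sizeq subnKC.
  have splitE : flatten (map (@turn_moves S) trs) = flatten (map (@turn_moves S) (take t.-1 trs))
      ++ Reloc s' d' :: map (@Retr S) (nth (no_turn S) trs t.-1).2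
      ++ flatten (map (@turn_moves S) (drop t trs)).
    rewrite -{1}(cat_take_drop t.-1 trs) (drop_nth (no_turn S)); last by lia.
    have tmE : turn_moves (nth (no_turn S) trs t.-1)
        = Reloc s' d' :: map (@Retr S) (nth (no_turn S) trs t.-1).2 by rewrite /turn_moves trE.
    by rewrite prednK // map_cat flatten_cat map_cons [flatten (_ :: _)]/= tmE.
  rewrite splitE in sol nm.
  exact: min_no_floor_to_floor c0wf mmin sol nm.
(* Each relocation of [pre] is one turn, and turn number [size pre] retrieves block 1. *)
exists s0, jb, p, (size pre) => t; split=> tp.
  have tp' : (t <= size pre')%N by move: tp; rewrite preE size_rcons.
  have [a' e] := stp t tp; exists a'; rewrite -e; congr (fun_of_fin _ _); congr (exec _ _).
  rewrite /trs /q -catA takel_cat ?size_map // -map_take flatten_reloc_turn.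
    by rewrite preE -cats1 takel_cat.
  by move: allp'; rewrite -{1}(cat_take_drop t pre') all_cat => /andP[].
have [k kE] : exists k, take t trs = map reloc_turn pre' ++ (Some (s, d), s0 :: rs) :: k.
  exists (take (t - size pre) (g ++ nseq (T - m) (no_turn S))).
  rewrite /trs /q -catA take_cat size_map ltnNge.
  have -> : (size pre' <= t)%N by move: tp; rewrite preE size_rcons; lia.
  rewrite /=; congr (_ ++ _); have -> : (t - size pre' = (t - size pre).+1)%N.
    by move: tp; rewrite preE size_rcons; lia.
  by [].
rewrite /stage kE map_cat flatten_cat flatten_reloc_turn // exec_cat map_cons.
rewrite -[flatten _]/(Reloc s d :: Retr s0 :: (map (@Retr S) rs
  ++ flatten (map (@turn_moves S) k))) !exec_cons -mvE.
have -> : next (exec c0 pre') mv = exec c0 pre by rewrite preE -cats1 exec_cat.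
by apply: absent_exec; rewrite -(remove_top prewf prep); apply: absent_remove.
Qed.

End Surgery.

(** * From move sequences to solutions *)

Section Invariants.
Variables B S H : nat.
Implicit Types (c : config S) (s d : 'I_S) (ms : seq (move S)).

Lemma size_exec c ms : (forall s, (size (c s) <= H)%N) -> legal_seq H c ms ->
  forall s, (size (exec c ms s) <= H)%N.
Proof.
elim: ms c => // mv ms IH c cH /andP[leg legs]; rewrite exec_cons; apply: IH legs => k.
case: mv leg => [s d|s] leg; rewrite ffunE.
  have [a [st [cs _ dH]]] := legal_relocP leg; rewrite cs /= take0.
  have := cH s; rewrite cs; case: eqP => _ /=; first exact: ltnW.
  by case: eqP.
by case: eqP => _ //; rewrite size_behead (leq_trans (leq_pred _)).
Qed.

Definition upclosed c : Prop :=
  forall i, inB B i -> inB B i.+1 -> present c i -> present c i.+1.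

(** Relocations keep the set of blocks and a retrieval takes the smallest label. *)
Lemma upclosed_exec c ms : wf B c -> upclosed c -> legal_seq H c ms -> upclosed (exec c ms).
Proof.
elim: ms c => // mv ms IH c cwf up /andP[leg legs]; rewrite exec_cons; apply: IH legs.
  exact: wf_next leg.
move=> i iB iB'; case: mv leg => [s d|s] leg.
  by have [a [st [cs sd _]]] := legal_relocP leg; rewrite !(present_reloc _ cwf cs sd); apply: up.
have [a [st [cs amin]]] := legal_retrP leg; rewrite !(present_retr _ cwf cs).
move=> /andP[pi ia]; rewrite up //=; have /existsP[k ik] := pi.
by have := amin _ _ ik; move: ia; lia.
Qed.

Lemma height_split c s l i r : wf B c -> c s = l ++ i :: r -> height c i = (size r).+1.
Proof.
move=> cwf cs; have il : i \notin l.
  by have := wf_uniq cwf s; rewrite cs cat_uniq => /and3P[_ /hasPn/(_ i (mem_head _ _))].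
have is_ : i \in c s by rewrite cs mem_cat mem_head orbT.
rewrite /height (big_pred1 s) => [|k].
  by rewrite cs size_cat index_cat (negPf il) /= eqxx addn0 addnC addnK.
by apply/idP/eqP => [ik|->//]; exact: (wf_disj cwf ik is_).
Qed.

Lemma height_gt0 c i : wf B c -> present c i -> (0 < height c i)%N.
Proof.
by move=> cwf /existsP[s]; case/splitPr e: _ / => [l r]; rewrite (height_split cwf e).
Qed.

Lemma height_le c i : wf B c -> (forall s, (size (c s) <= H)%N) -> (height c i <= H)%N.
Proof.
move=> cwf cH; have [/existsP[s is_]|ab] := boolP (present c i).
  rewrite /height (big_pred1 s) => [|k]; first by rewrite (leq_trans (leq_subr _ _)).
  by apply/idP/eqP => [ik|->//]; exact: (wf_disj cwf ik is_).
rewrite /height big1 // => s is_; case/negP: ab; by apply/existsP; exists s.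
Qed.

Lemma lies_on_split c i j : lies_on B c i j -> (j <= B)%N ->
  exists s l r, c s = l ++ i :: j :: r.
Proof. by rewrite lies_on_adj => /existsP[s /adj_split h] /h[l [r e]]; exists s, l, r. Qed.

Lemma lies_on_presentr c i j : lies_on B c i j -> (j <= B)%N -> present c j.
Proof.
move=> ij /(lies_on_split ij)[s [l [r e]]]; apply/existsP; exists s.
by rewrite e mem_cat !inE eqxx !orbT.
Qed.

Lemma lies_on_height c i j : wf B c -> lies_on B c i j -> (j <= B)%N ->
  height c i = (height c j).+1.
Proof.
move=> cwf ij /(lies_on_split ij)[s [l [r e]]].
rewrite (height_split cwf e); rewrite -cat_rcons in e.
by rewrite (height_split cwf e).
Qed.

Lemma lies_on_neq c i j : wf B c -> lies_on B c i j -> j != i.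
Proof.
move=> cwf; rewrite lies_on_adj => /existsP[s].
exact: adj_neq (wf_uniq cwf s) (wf_range cwf s).
Qed.

End Invariants.

(** * The encoding of an optimal sequence is feasible for BRP-m3 *)

Section Feasibility.
Variables (R : realFieldType) (B S H L T m : nat) (c0 : config S) (trs : seq (turn S)).
Hypothesis c0_wf : wf B c0.
Hypothesis c0_present : forall i, inB B i -> present c0 i.
Hypothesis c0_size : forall s, (size (c0 s) <= H)%N.
Hypothesis B_gt0 : (0 < B)%N.
Hypothesis L_gt0 : (0 < L)%N.
Hypothesis Lm : (L <= m)%N.
Hypothesis mT : (m <= T)%N.
Hypothesis trs_size : size trs = T.
Hypothesis trs_solves : solves H c0 (flatten (map (@turn_moves S) trs)).
Let turn_at t := nth (no_turn S) trs t.-1.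
Let st t := stage c0 trs t.
Hypothesis trs_reloc : forall t, inT T t -> isSome (turn_at t).1 = (t <= m)%N.
Hypothesis trs_floor : forall t s d, inT T t -> (turn_at t).1 = Some (s, d) ->
  ~~ ((below B (behead (st t.-1 s)) == B.+1) && (below B (st t.-1 d) == B.+1)).

(** The configuration just after the put-down of turn t, where the heights u are taken. *)
Definition mid t : config S := exec (st t.-1) (reloc_moves (turn_at t).1).

Hypothesis mid_height1 : forall t, inT T t -> present (mid t) 1 ->
  height (mid t) 1 = height c0 1.

(* Constraint (u2) also binds retrieved blocks, whose height in [mid t] is 0; (e7) moreover
   asks for the constant height of block 1 after its retrieval. *)
Definition u_value i t : nat := if i == 1%N then height c0 1 else maxn 1 (height (mid t) i).

Definition encoding : solution R := {|
  vx := fun i j t => (lies_on B (st t) i j)%:R;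
  yhat := fun i j t => (occurs (lifts B i j) (st t.-1) (turn_moves (turn_at t)))%:R;
  ycheck := fun i j t => (occurs (puts B i j) (st t.-1) (turn_moves (turn_at t)))%:R;
  vz := fun i j t => (occurs (retrieves B i j) (st t.-1) (turn_moves (turn_at t)))%:R;
  vu := fun i t => (u_value i t)%:R |}.

Let v := encoding.

Lemma flatten_take_legal t : legal_seq H c0 (flatten (map (@turn_moves S) (take t trs))).
Proof.
case/andP: trs_solves; rewrite -{1}(cat_take_drop t trs) map_cat flatten_cat legal_seq_cat.
by case/andP.
Qed.

Lemma stage_wf t : wf B (st t).
Proof. by apply: wf_exec (flatten_take_legal t). Qed.

Lemma stage_step t : inT T t -> st t = exec (st t.-1) (turn_moves (turn_at t)).
Proof.
move=> /andP[t0 tT]; rewrite /st /stage -{1}(prednK t0) (take_nth (no_turn S)); last first.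
  by rewrite trs_size prednK.
by rewrite map_rcons -cats1 flatten_cat /= cats0 exec_cat.
Qed.

Lemma turn_legal t : inT T t -> legal_seq H (st t.-1) (turn_moves (turn_at t)).
Proof.
move=> /andP[t0 tT]; have := flatten_take_legal t.
rewrite -{1}(prednK t0) (take_nth (no_turn S)); last by rewrite trs_size prednK.
by rewrite map_rcons -cats1 flatten_cat /= cats0 legal_seq_cat => /andP[].
Qed.

Lemma turn_legal_reloc t : inT T t -> legal_seq H (st t.-1) (reloc_moves (turn_at t).1).
Proof. by move/turn_legal; rewrite legal_seq_cat => /andP[]. Qed.

Lemma turn_legal_retr t : inT T t -> legal_seq H (mid t) (map (@Retr S) (turn_at t).2).
Proof. by move/turn_legal; rewrite legal_seq_cat => /andP[]. Qed.

Lemma mid_wf t : inT T t -> wf B (mid t).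
Proof. by move/turn_legal_reloc; apply: wf_exec; apply: stage_wf. Qed.

Lemma mid_size t s : inT T t -> (size (mid t s) <= H)%N.
Proof.
move=> tT; apply: (size_exec _ (turn_legal_reloc tT)) => s'.
exact: (size_exec c0_size (flatten_take_legal _)).
Qed.

Lemma mid_on i j t : inT T t ->
  (lies_on B (mid t) i j)%:R = vx v i j t.-1 - yhat v i j t + ycheck v i j t :> R.
Proof.
move=> tT; rewrite /= turn_lifts turn_puts.
exact: natr_lies_on_mid (stage_wf _) (turn_legal_reloc tT).
Qed.

Lemma stage_on i j t : inT T t ->
  vx v i j t = (lies_on B (mid t) i j)%:R - vz v i j t.
Proof.
move=> tT; rewrite /= turn_retrieves stage_step // exec_cat.
exact: natr_lies_on_retrs (mid_wf tT) (turn_legal_retr tT).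
Qed.

Lemma z_lt i j t : inT T t -> (j < i)%N -> vz v i j t = 0.
Proof.
move=> tT ji; rewrite /= turn_retrieves.
by rewrite (occurs_retrieves_lt (mid_wf tT) (turn_legal_retr tT)).
Qed.

Lemma mid_present i t : inT T t -> present (mid t) i = present (st t.-1) i.
Proof.
move=> tT; rewrite /mid; have := turn_legal_reloc tT.
case: (turn_at t).1 => [[s d]|] //= /andP[leg _].
by have [a [stk [cs sd _]]] := legal_relocP leg; rewrite (present_reloc _ (stage_wf _) cs sd).
Qed.

(** Gives [yhat] and [ycheck] of a turn as zero or as explicit unit entries, so that each constraint
    reduces to the point sums. *)
Variant turn_spec t : Prop :=
| NoReloc of (turn_at t).1 = None & (forall i j, yhat v i j t = 0) &
    (forall i j, ycheck v i j t = 0)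
| SomeReloc s d a stk of (turn_at t).1 = Some (s, d) & st t.-1 s = a :: stk & s != d &
    (forall i j, yhat v i j t = ((i == a) && (j == below B stk))%:R) &
    (forall i j, ycheck v i j t = ((i == a) && (j == below B (st t.-1 d)))%:R).

Lemma turnP t : inT T t -> turn_spec t.
Proof.
move=> tT; have := turn_legal_reloc tT; case o: (turn_at t).1 => [[s d]|]; last first.
  by move=> _; apply: NoReloc => // i j; rewrite /= ?turn_lifts ?turn_puts o.
rewrite -[legal_seq _ _ _]/(_ && true) andbT => /legal_relocP[a [stk [cs sd _]]].
apply: (SomeReloc o cs sd) => i j; rewrite /= ?turn_lifts ?turn_puts o.
  by rewrite /reloc_moves occurs_cons orbF (lifts_top _ d i j cs).
by rewrite /reloc_moves occurs_cons orbF (puts_top _ d i j cs).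
Qed.

Lemma enc_x1 i j : vx v i j 0 = initC R B c0 i j.
Proof. by rewrite /= /st /stage take0. Qed.

Lemma enc_x2 i j t : (j < i)%N -> inT T t ->
  vx v i j t = vx v i j t.-1 - yhat v i j t + ycheck v i j t.
Proof. by move=> ji tT; rewrite stage_on // mid_on // z_lt // subr0. Qed.

Lemma enc_x3 i j t : inT T t ->
  vx v i j t = vx v i j t.-1 - yhat v i j t + ycheck v i j t - vz v i j t.
Proof. by move=> tT; rewrite stage_on // mid_on. Qed.

Lemma stage_last : st T = [ffun=> [::]].
Proof. by rewrite /st /stage take_oversize ?trs_size //; case/andP: trs_solves => _ /eqP. Qed.

Lemma enc_x4 i j : vx v i j T = 0.
Proof.
rewrite /= stage_last lies_on_adj; case: existsP => // -[s].
by rewrite ffunE.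
Qed.

Lemma enc_x_row i t : \sum_(1 <= j < B.+2 | j != i) vx v i j t = (present (st t) i)%:R.
Proof. exact: sum_lies_on_row (stage_wf t). Qed.

Lemma enc_x_col j t : inB B j ->
  \sum_(1 <= i < B.+1 | i != j) vx v i j t = (present (st t) j)%:R - (topmost (st t) j)%:R.
Proof. exact: sum_lies_on_col (stage_wf t). Qed.

Section Relocation.
Variables (t : nat) (s d : 'I_S) (a : nat) (stk : seq nat).
Hypothesis cs : st t.-1 s = a :: stk.
Hypothesis sd : s != d.

Lemma source_range : [/\ inB B a, inB' B (below B stk) & below B stk != a].
Proof.
have [aB stB] := wf_top_range (stage_wf _) cs; split=> //; first exact: below_range.
exact/below_neq/(wf_top_notin (stage_wf _) cs).
Qed.

Lemma target_range : inB' B (below B (st t.-1 d)) /\ below B (st t.-1 d) != a.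
Proof.
have [aB _ _] := source_range; split; first exact/below_range/wf_range/stage_wf.
exact/below_neq/(wf_top_other (stage_wf _) cs sd).
Qed.

Lemma source_top : topmost (st t.-1) a.
Proof. by apply/existsP; exists s; rewrite cs. Qed.

Lemma target_top i : inB B i -> i = below B (st t.-1 d) -> topmost (st t.-1) i.
Proof.
move=> iB iE; apply/existsP; exists d; rewrite iE.
by have := below_mem iB iE; case: (st t.-1 d).
Qed.

Lemma source_present i : inB B i -> i = below B stk -> present (st t.-1) i.
Proof.
move=> iB iE; apply/existsP; exists s; rewrite cs inE; apply/orP; right.
exact: below_mem iB iE.
Qed.

(** Otherwise [i] would be in two stacks. This yields (ycheck2); the analogous case of the floor is
    excluded by [trs_floor]. *)
Lemma source_neq_target i : inB B i -> i = below B stk -> i <> below B (st t.-1 d).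
Proof.
move=> iB i1 i2; case/eqP: sd.
apply: (wf_disj (stage_wf t.-1) (b := i)); last exact: below_mem iB i2.
by rewrite cs inE (below_mem iB i1) orbT.
Qed.

End Relocation.

Lemma enc_yhat_row i t : inT T t -> \sum_(1 <= j < B.+2 | j != i) yhat v i j t
  = if (turn_at t).1 is Some (s, _) then (ohead (st t.-1 s) == Some i)%:R else 0.
Proof.
move=> tT; case: (turnP tT) => [-> yh _|s d a stk -> cs sd yh _].
  by rewrite big1.
have [aB jB ja] := source_range cs; under eq_bigr do rewrite yh.
by rewrite sum_row_point // cs /= (inj_eq Some_inj) eq_sym.
Qed.

Lemma enc_ycheck1 i t : inT T t -> \sum_(1 <= j < B.+2 | j != i) ycheck v i j t
  = \sum_(1 <= j < B.+2 | j != i) yhat v i j t.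
Proof.
move=> tT; case: (turnP tT) => [_ yh yc|s d a stk _ cs sd yh yc].
  by rewrite !big1.
have [aB jB ja] := source_range cs; have [j'B j'a] := target_range cs sd.
under eq_bigr do rewrite yc; under [RHS]eq_bigr do rewrite yh.
by rewrite !sum_row_point.
Qed.

Lemma enc_lift_total t : inT T t ->
  \sum_(1 <= i < B.+1) \sum_(1 <= j < B.+2 | j != i) yhat v i j t = (t <= m)%:R.
Proof.
move=> tT; rewrite -trs_reloc //; under eq_bigr do rewrite enc_yhat_row //.
case: (turnP tT) => [-> _ _|s d a stk -> cs _ _ _]; first by rewrite big1.
have [aB _ _] := source_range cs; rewrite cs.
under eq_bigr do rewrite /= (inj_eq Some_inj) eq_sym.
by rewrite sum_nat_pred1 ltnS; move: aB; rewrite /inB => /andP[-> ->].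
Qed.

Lemma u_value_range i t : inB B i -> inT T t -> (1 <= u_value i t <= H)%N.
Proof.
move=> iB tT; have B1 : inB B 1 by rewrite /inB B_gt0.
have h1 := height_gt0 c0_wf (c0_present B1).
have h1H : (height c0 1 <= H)%N by apply: height_le c0_wf c0_size.
rewrite /u_value; case: eqP => _; first by rewrite h1.
have := height_le i (mid_wf tT) (fun s => mid_size s tT); lia.
Qed.

Lemma u_value_height i t : inB B i -> inT T t -> present (mid t) i ->
  u_value i t = height (mid t) i.
Proof.
move=> iB tT pi; rewrite /u_value; case: eqP => [i1|_]; first by rewrite i1 mid_height1 // -i1.
by have := height_gt0 (mid_wf tT) pi; lia.
Qed.

(** If [i] lies on [j] after the put-down, their heights differ by 1. If not, the slack [H]
    suffices, since all values lie between 1 and [H]. *)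
Lemma enc_u1 i j t : inB B i -> inB B j -> inT T t ->
  vu v i t >= vu v j t + 1 - H%:R * (1 - vx v i j t.-1 + yhat v i j t - ycheck v i j t).
Proof.
move=> iB jB tT; have -> : 1 - vx v i j t.-1 + yhat v i j t - ycheck v i j t
    = 1 - (lies_on B (mid t) i j)%:R by rewrite mid_on //; lra.
rewrite [vu v i t]/= [vu v j t]/=; have [ij|_] := boolP (lies_on B (mid t) i j).
  have jle : (j <= B)%N by case/andP: jB.
  rewrite subrr mulr0 subr0 (u_value_height iB) // ?(lies_on_present ij) //.
  rewrite (u_value_height jB) // ?(lies_on_presentr ij) //.
  by rewrite (lies_on_height (mid_wf tT) ij) // -natr1.
rewrite subr0 mulr1 lerBlDr natr1 -natrD ler_nat.
by have := u_value_range iB tT; have := u_value_range jB tT; lia.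
Qed.

(** By [x_row] both cumulated sums are 1 minus a presence indicator, and the set of present blocks
    is closed upwards. *)
Lemma enc_z3 i t : inB B i -> i != 1%N -> inT T t ->
  \sum_(1 <= j < B.+2 | (i < j)%N) \sum_(1 <= tau < t.+1) vz v i j tau <=
  \sum_(1 <= j < B.+2 | (i.-1 < j)%N) \sum_(1 <= tau < t.+1) vz v i.-1 j tau.
Proof.
move=> iB i1 tT; have i'B : inB B i.-1 by move: iB i1; rewrite /inB; lia.
have tT1 : (t <= T)%N by case/andP: tT.
have rows k kB := x_row (T := T) (v := v) c0_wf c0_present (fun i j _ _ _ => enc_x1 i j)
  (fun i j t _ _ => @enc_x2 i j t) (fun i j t _ _ _ => @enc_x3 i j t)
  (fun i t _ => @enc_ycheck1 i t) (i := k) kB tT1.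
have := rows i iB; have := rows _ i'B; rewrite !enc_x_row => e1 e2.
have up : upclosed B (st t).
  apply: upclosed_exec c0_wf _ (flatten_take_legal t).
  by move=> k _ kB _; apply: c0_present.
have : (present (st t) i.-1)%:R <= (present (st t) i)%:R :> R.
  rewrite ler_nat; have := up _ i'B; rewrite prednK; last by case/andP: iB.
  by move=> /(_ iB); case: (present _ i.-1); case: (present _ i) => // /(_ isT).
by rewrite e1 e2; lra.
Qed.

Lemma enc_common : common B H L T c0 v.
Proof.
have B_B' i : inB B i -> inB' B i by rewrite /inB /inB'; lia.
split.
- by move=> i j _ _ _; apply: enc_x1.
- by move=> i j t _ _; apply: enc_x2.
- by move=> i j t _ _ _; apply: enc_x3.
- by move=> i j _ _ _; apply: enc_x4.
- by move=> t tT tL; rewrite enc_lift_total // (leq_trans tL).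
- move=> t tT tL; have tT' : inT T t.-1 by move: tT; rewrite /inT; lia.
  rewrite !enc_lift_total // ler_nat; case: (leqP t m) => //= tm.
  by have -> : (t.-1 <= m)%N by lia.
- move=> i t iB tT; rewrite enc_yhat_row // enc_x_row enc_x_col // opprB addrC subrK.
  case: (turnP tT) => [-> _ _|s d a stk -> cs _ _ _]; first exact: ler0n.
  rewrite cs /= ler_nat; have [[<-]|_] := eqVneq (Some a) (Some i); last by [].
  by rewrite (source_top cs).
- by move=> *; apply: binary_bool.
- by move=> i t _; apply: enc_ycheck1.
- move=> i t iB tT; rewrite enc_x_row.
  case: (turnP tT) => [_ yh yc|s d a stk _ cs sd yh yc]; first by rewrite !big1 // subr0 ler0n.
  under eq_bigr do rewrite yc; under [X in _ <= _ - X]eq_bigr do rewrite yh.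
  have [aB jB ja] := source_range cs; have [j'B j'a] := target_range cs sd.
  rewrite !sum_col_point //; case: eqP => [i1|_]; case: eqP => [i2|_] /=.
  + by case: (source_neq_target cs sd iB i2).
  + by rewrite subr0 (topmost_present (target_top iB i1)).
  + by rewrite (source_present cs iB i2) subrr.
  + by rewrite subr0 ler0n.
- move=> t tT; case: (turnP tT) => [_ yh yc|s d a stk o cs sd yh yc].
    by rewrite !big1 // subr0 ler01.
  under eq_bigr do rewrite yc; under [X in _ <= _ - X]eq_bigr do rewrite yh.
  have [aB jB ja] := source_range cs; rewrite !sum_floor_point //.
  (* (ycheck3) fails only for a move from floor to floor. *)
  have := trs_floor tT o; rewrite cs /= ![_ == B.+1]eq_sym.
  by case: (_ == _); case: (_ == _); rewrite //= ?subrr ?subr0 ?ler01 ?lexx.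
- move=> i t iB tT; rewrite enc_x_row enc_x_col // opprB addrC subrK.
  case: (turnP tT) => [_ _ yc|s d a stk _ cs sd _ yc]; first by rewrite big1 // ler0n.
  under eq_bigr do rewrite yc.
  have [aB _ _] := source_range cs; have [j'B j'a] := target_range cs sd.
  rewrite sum_col_point //; case: eqP => [i1|_]; last exact: ler0n.
  by rewrite (target_top iB i1).
- move=> t tT; rewrite (sum_lies_on_floor R (stage_wf t.-1)).
  have le1 k : (st t.-1 k != [::])%:R <= 1 :> R by rewrite lern1 leq_b1.
  have sumS (P : pred 'I_S) : \sum_(k | P k) (st t.-1 k != [::])%:R <= #|P|%:R :> R.
    by rewrite -sumr_const; apply: ler_sum.
  case: (turnP tT) => [_ _ yc|s d a stk _ cs sd _ yc].
    by rewrite big1 // subr_ge0; have := sumS xpredT; rewrite card_ord.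
  under eq_bigr do rewrite yc.
  have [aB _ _] := source_range cs; rewrite sum_floor_point //; case: eqP => [e|_].
    (* A put-down on the floor needs an empty stack, which leaves at most [S] - 1 nonempty ones. *)
    have d0 : st t.-1 d = [::] by apply: below_floor (stage_wf _) (esym e).
    rewrite (bigD1 d) //= d0 add0r lerBrDr; apply: (le_trans (lerD (lexx 1) (sumS _))).
    rewrite -[1]/(1%:R) -natrD ler_nat -[X in (_ <= X)%N](card_ord S) [X in (_ <= X)%N](cardD1 d).
    by rewrite inE leq_add2l; apply/eq_leq/eq_card => k; rewrite !inE andbT.
  by rewrite subr_ge0; have := sumS xpredT; rewrite card_ord.
- by move=> *; apply: binary_bool.
- exact: enc_z3.
- by move=> *; apply: binary_bool.
- by move=> i j t iB jB _ tT; apply: enc_u1.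
Qed.

Lemma enc_yhat3 i j t : inT T t -> yhat v i j t <= vx v i j t.-1.
Proof.
move=> tT; case: (turnP tT) => [_ -> _|s d a stk _ cs _ -> _]; first exact: ler0n.
rewrite /= ler_nat; case: eqP => [->|//]; rewrite (lies_on_top _ (stage_wf _) cs).
by case: eqP.
Qed.

Lemma enc_z1 i j t : inT T t ->
  vz v i j t <= vx v i j t.-1 - yhat v i j t + ycheck v i j t.
Proof.
move=> tT; rewrite -mid_on // -subr_ge0 -stage_on //; exact: ler0n.
Qed.

(** If [i] stays, its row of z is 0 and at most one block lies on it. If [i] is absent after the
    turn, no larger block lay on it after the put-down, because that block would still lie there. *)
Lemma enc_z2 i t : inB B i -> inT T t ->
  \sum_(1 <= j < B.+2 | (i < j)%N) vz v i j t <=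
  \sum_(1 <= j < B.+2 | j != i) vx v i j t.-1
    - \sum_(1 <= j < B.+1 | (i < j)%N) (vx v j i t.-1 - yhat v j i t + ycheck v j i t).
Proof.
move=> iB tT; under [X in _ <= _ - X]eq_bigr do rewrite -mid_on //.
have := x_row_step (T := T) (v := v) (fun i j t _ _ => @enc_x2 i j t)
  (fun i j t _ _ _ => @enc_x3 i j t) (fun i t _ => @enc_ycheck1 i t) iB tT.
rewrite !enc_x_row; set zs := \sum_(1 <= j < B.+2 | (i < j)%N) _ => zsE.
set ws := \sum_(1 <= j < B.+1 | _) _.
have [pi|pi] := boolP (present (st t) i); last first.
  suff -> : ws = 0 by rewrite (negPf pi) /= in zsE; lra.
  rewrite /ws big1 // => j ij; have [ji|//] := boolP (lies_on B (mid t) j i).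
  have := stage_on j i tT; rewrite z_lt // ji subr0 => /eqP.
  rewrite /= -[1]/(true%:R) eqr_nat; case: (boolP (lies_on B (st t) j i)) => // ji' _.
  by case/negP: pi; apply: lies_on_presentr ji' _; case/andP: iB.
have pi' : present (st t.-1) i.
  have zs0 : 0 <= zs by apply: sumr_ge0 => j _; apply: ler0n.
  by move: zsE zs0; rewrite pi; case: (present (st t.-1) i) => //=; lra.
have ws1 : ws <= 1.
  apply: (@le_trans _ _ (\sum_(1 <= j < B.+1 | j != i) (lies_on B (mid t) j i)%:R)).
    rewrite /ws big_mkcond [X in _ <= X]big_mkcond; apply: ler_sum => j _.
    by case: ltnP => [ij|_]; [rewrite gtn_eqF|case: ifP => // _; apply: ler0n].
  rewrite (sum_lies_on_col R (mid_wf tT) iB) mid_present // pi'.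
  by rewrite gerBl ler0n.
by move: zsE; rewrite pi pi' /=; lra.
Qed.

Lemma enc_m3 : brp_m3 B H L T c0 v.
Proof.
split; first exact: enc_common.
- by move=> *; apply: binary_bool.
- by move=> i j t _ _ _; apply: enc_yhat3.
- by move=> i j t _ _ _; apply: enc_z1.
- exact: enc_z2.
- by move=> i t iB tT; exists (u_value i t); split=> //; apply: u_value_range.
Qed.

Lemma enc_objective : objective B T v = m%:R.
Proof.
rewrite (objectiveE enc_common) -(sum_leq_nat mT) natr_sum.
by apply: eq_big_nat => t tT; apply: enc_lift_total.
Qed.

End Feasibility.

(** * The equalities (e1)-(e7) for solutions in which block 1 rests until it is retrieved *)

Section Simplification.
Variables (R : realFieldType) (B S H L T : nat) (c0 : config S) (v : solution R).
Hypothesis c0_wf : wf B c0.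
Hypothesis B_gt0 : (0 < B)%N.
Hypothesis c0_blocked : block1_not_topmost c0.
Hypothesis m3 : brp_m3 B H L T c0 v.
Variable remains : nat -> bool.
Hypothesis x_below1 : forall j t, (t <= T)%N ->
  vx v 1 j t = (remains t && lies_on B c0 1 j)%:R.
Hypothesis x_above1 : forall j t, (t <= T)%N ->
  vx v j 1 t = (remains t && lies_on B c0 j 1)%:R.
Hypothesis u_block1 : forall t, inT T t -> vu v 1 t = (height c0 1)%:R.

Let com := m3_common m3.

Lemma inB1 : inB B 1. Proof. by rewrite /inB B_gt0. Qed.

Lemma inB'1 : inB' B 1. Proof. by []. Qed.

(** Block 1 is never topmost at the end of a turn: it is covered as initially, or gone. Thus (yhat4)
    and (ycheck4) forbid lifting it or putting anything on it. *)
Lemma block1_blocked t : (t <= T)%N ->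
  \sum_(1 <= j < B.+2 | j != 1%N) vx v 1 j t - \sum_(1 <= j < B.+1 | j != 1%N) vx v j 1 t = 0.
Proof.
move=> tT; under eq_bigr do rewrite x_below1 //.
under [X in _ - X]eq_bigr do rewrite x_above1 //.
case: (remains t); last by rewrite !big1 ?subrr.
rewrite sum_lies_on_row // sum_lies_on_col ?inB1 //.
have -> : topmost c0 1 = false.
  by apply/negbTE; rewrite negb_exists; apply/forallP.
by rewrite /=; lra.
Qed.

Lemma block1_fixed i t : inB' B i -> i != 1%N -> inT T t ->
  yhat v 1 i t = 0 /\ ycheck v 1 i t = 0.
Proof.
move=> iB i1 tT; have tT1 : (t.-1 <= T)%N by move: tT; rewrite /inT; lia.
have yh0 : forall j, j \in index_iota 1 B.+2 -> j != 1%N -> yhat v 1 j t = 0.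
  apply: nonneg_sum0 => [j|]; last first.
    by have := cons_yhat4 com inB1 tT; rewrite block1_blocked.
  by rewrite mem_B' => jB j1; apply/binary_ge0/(cons_yhat5 com) => //; apply: inB1.
split; first by apply: yh0; rewrite ?mem_B'.
have yc0 : forall j, j \in index_iota 1 B.+2 -> j != 1%N -> ycheck v 1 j t = 0.
  apply: nonneg_sum0 => [j|].
    by rewrite mem_B' => jB j1; apply/binary_ge0/(cons_ycheck6 com) => //; apply: inB1.
  rewrite (cons_ycheck1 com) ?inB1 // big_seq_cond big1 // => j /andP[jr j1].
  exact: yh0.
by apply: yc0; rewrite ?mem_B'.
Qed.

Lemma block1_untouched i t : inB B i -> i != 1%N -> inT T t -> ycheck v i 1 t = 0.
Proof.
move=> iB i1 tT; have tT1 : (t.-1 <= T)%N by move: tT; rewrite /inT; lia.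
have yc0 : forall j, j \in index_iota 1 B.+1 -> j != 1%N -> ycheck v j 1 t = 0.
  apply: nonneg_sum0 => [j|]; last first.
    by have := cons_ycheck4 com inB1 tT; rewrite block1_blocked.
  by rewrite mem_B => jB j1; apply/binary_ge0/(cons_ycheck6 com); rewrite // eq_sym.
by apply: yc0; rewrite ?mem_B.
Qed.

Lemma lifted_off_block1 i t : inB B i -> i != 1%N -> inT T t ->
  yhat v i 1 t = vx v i 1 t.-1 - vx v i 1 t.
Proof.
move=> iB i1 tT; have i_gt1 : (1 < i)%N by move: iB i1; rewrite /inB; lia.
by have := cons_x2 com iB inB'1 i_gt1 tT; rewrite block1_untouched // => ->; lra.
Qed.

Lemma retrieved_block1 i t : inB' B i -> i != 1%N -> inT T t ->
  vz v 1 i t = vx v 1 i t.-1 - vx v 1 i t.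
Proof.
move=> iB i1 tT; have i_gt1 : (1 < i)%N by move: iB i1; rewrite /inB'; lia.
by have := cons_x3 com inB1 iB i_gt1 tT; have [-> ->] := block1_fixed iB i1 tT => ->; lra.
Qed.

Lemma m3_simplified : brp_m3_simplified B H L T c0 v.
Proof.
have le_T t : inT T t -> (t <= T)%N /\ (t.-1 <= T)%N by rewrite /inT; lia.
split; first exact: com.
- by move=> i j t iB jB ji tT; case: (cons_x5 m3 iB jB ji tT) => ->; rewrite ?lexx ler01.
- by move=> i t iB tT; have [k [/andP[k1 kH] ->]] := cons_u2 m3 iB tT; rewrite ler1n k1 ler_nat.
(* For (e1), both sides equal the drop of [remains] during turn t. *)
- move=> i j t iB on1i jB onj1 tT; have [tT1 tT0] := le_T t tT.
  have i1 := lies_on_neq c0_wf on1i; have j1 := lies_on_neq c0_wf onj1.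
  rewrite retrieved_block1 // lifted_off_block1 // 1?eq_sym //.
  by rewrite !x_below1 // !x_above1 // on1i onj1.
- move=> i iB oni1; have i1 : i != 1%N by rewrite eq_sym (lies_on_neq c0_wf oni1).
  (* For (e2), the sum telescopes to the initial entry 1 minus the final entry 0. *)
  transitivity (\sum_(1 <= t < T.+1) (vx v i 1 t.-1 - vx v i 1 t)).
    by apply: eq_big_nat => t tT; rewrite lifted_off_block1.
  have tele n : \sum_(1 <= t < n.+1) (vx v i 1 t.-1 - vx v i 1 t) = vx v i 1 0 - vx v i 1 n.
    by elim: n => [|n IH]; [rewrite big_geq // subrr|rewrite big_nat_recr //= IH; lra].
  rewrite tele (cons_x1 com) ?inB'1 1?eq_sym // (cons_x4 com) 1?eq_sym // /initC oni1.
  by rewrite subr0.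
- exact: block1_untouched.
- move=> i t iB i1 oni1 tT; have [tT1 tT0] := le_T t tT.
  by rewrite lifted_off_block1 // !x_above1 // (negPf oni1) !andbF subrr.
- exact: block1_fixed.
- move=> i t iB i1 on1i tT; have [tT1 tT0] := le_T t tT.
  by rewrite retrieved_block1 // !x_below1 // (negPf on1i) !andbF subrr.
- exact: u_block1.
Qed.

End Simplification.

(** * Consequences of a valid initial configuration *)

Section InitialConfiguration.
Variables (B S H : nat) (c : config S).
Implicit Types s : 'I_S.

(** Multiplicities over all stacks carry the whole permutation hypothesis: uniqueness, disjointness,
    range and presence are read off from them. *)
Lemma valid_config_count b : valid_config B H c ->
  (\sum_s count_mem b (c s) = inB B b)%N.
Proof.
move=> [/seq.permP/(_ (pred1 b)) e _]; rewrite count_flatten -map_comp sumnE big_map big_enum in e.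
by rewrite [LHS]e count_uniq_mem ?iota_uniq // mem_iota /inB add1n ltnS.
Qed.

Lemma valid_config_wf : valid_config B H c -> wf B c.
Proof.
move=> cv; have cnt b := valid_config_count b cv.
have le1 s b : (count_mem b (c s) <= inB B b)%N by rewrite -cnt (bigD1 s) //= leq_addr.
split.
- move=> s; apply: count_mem_uniq => b; apply/eqP; rewrite eqn_leq -has_pred1 has_count.
  by have := le1 s b; have := leq_b1 (inB B b); lia.
- move=> s s' b; rewrite -!has_pred1 !has_count => bs bs'; apply/eqP/negPn/negP => ss'.
  have : (count_mem b (c s) + count_mem b (c s') <= inB B b)%N.
    by rewrite -cnt (bigD1 s) //= (bigD1 s') 1?eq_sym //= addnA leq_addr.
  by have := leq_b1 (inB B b); lia.
- move=> s; apply/allP => b; rewrite -has_pred1 has_count.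
  by have := le1 s b; case: (inB B b) => //; lia.
Qed.

Lemma valid_config_present i : valid_config B H c -> inB B i -> present c i.
Proof.
move=> cv iB; case: (boolP (present c i)) => //; rewrite negb_exists => /forallP ab.
have := valid_config_count i cv; rewrite iB big1 // => s _.
by apply/eqP; rewrite -leqn0 leqNgt -has_count has_pred1.
Qed.

Lemma lies_on_mem s l i r j : wf B c -> c s = l ++ i :: r ->
  lies_on B c i j = (j == below B r).
Proof.
move=> cwf cs; have is_ : i \in c s by rewrite cs mem_cat mem_head orbT.
have us := wf_uniq cwf s; rewrite lies_on_adj.
have -> : [exists k, adj B (c k) i j] = adj B (c s) i j.
  apply/existsP/idP => [[k adjk]|]; last by exists s.
  by rewrite -(wf_disj cwf (adj_mem adjk) is_).
rewrite cs in us *; elim: l us {cs is_} => [|a l IH] /= /andP[ai us].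
  by rewrite eqxx orb_idr // => /adj_mem ir; rewrite ir in ai.
rewrite IH // orb_idl // => /andP[/eqP ia _].
by move: ai; rewrite -ia mem_cat mem_head orbT.
Qed.

Lemma lies_on_mem_above s l a i r j : wf B c -> c s = l ++ a :: i :: r ->
  lies_on B c j i = (j == a).
Proof.
move=> cwf cs; have is_ : i \in c s by rewrite cs mem_cat !inE eqxx !orbT.
have iB : (i <= B)%N by have /andP[] := wf_inB cwf is_.
have us := wf_uniq cwf s.
apply/idP/eqP => [ji|->]; last by rewrite (lies_on_mem i cwf cs) eqxx.
have [s' [l' [r' cs']]] := lies_on_split ji iB.
have es : s' = s by apply: (wf_disj cwf _ is_); rewrite cs' mem_cat !inE eqxx !orbT.
rewrite es in cs'; have index_i l0 a0 r0 : c s = l0 ++ a0 :: i :: r0 ->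
    index i (c s) = (size l0).+1 /\ nth 0%N (c s) (size l0) = a0.
  move=> e; rewrite e nth_cat ltnn subnn; split=> //.
  move: us; rewrite e -cat_rcons cat_uniq => /and3P[_ /hasPn/(_ i (mem_head _ _)) il _].
  by rewrite index_cat (negPf il) /= eqxx addn0 size_rcons.
have [e1 n1] := index_i _ _ _ cs; have [e2 n2] := index_i _ _ _ cs'.
by rewrite -n1 -n2; congr (nth _ _ _); move: e1; rewrite e2 => -[].
Qed.

End InitialConfiguration.

Theorem proposition1 (R : realFieldType) (B S H L T m : nat) (c0 : config S)
    (B_gt0 : (0 < B)%N)
    (c0_valid : valid_config B H c0)
    (c0_blocked : block1_not_topmost c0)
    (m_min : min_relocations H c0 m)
    (L_gt0 : (0 < L)%N) (L_lower : (L <= m)%N) (T_upper : (m <= T)%N) :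
  [/\ optimal_value B T (@brp_m3 R B S H L T c0) m%:R,
      optimal_value B T (@brp_m3_simplified R B S H L T c0) m%:R &
      forall v : solution R,
        optimal B T (@brp_m3_simplified R B S H L T c0) v ->
        exists ms : seq (move S),
          [/\ solves H c0 ms, nreloc ms = m & encodes B T c0 v ms]].
Proof.
have c0wf := valid_config_wf c0_valid.
have c0pres i (iB : inB B i) := valid_config_present c0_valid iB.
have B1 : inB B 1 by rewrite /inB B_gt0.
have [trs [szT sol reloc floor [s0 [jb [p [t1 eager]]]]]] :=
  eager_turns c0wf (c0pres _ B1) c0_blocked m_min T_upper.
have stage0 : stage c0 trs 0 = c0 by rewrite /stage take0.
have t1_gt0 : (0 < t1)%N.
  rewrite lt0n; apply/eqP => t10; have [_] := eager 0%N; rewrite t10 stage0.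
  by move=> /(_ isT)/negP[]; apply: c0pres.
have [a0 cs0] : exists a, c0 s0 = a ++ jb :: 1%N :: p.
  by have [/(_ t1_gt0)] := eager 0%N; rewrite stage0.
(* If block 1 is present when a turn starts, [jb] covers it, so the relocation of that turn leaves
   block 1 and the part [p] beneath it in place. *)
have mid1 t : inT T t -> present (mid c0 trs t) 1 -> height (mid c0 trs t) 1 = height c0 1.
  move=> tT; rewrite (mid_present c0wf szT sol) //.
  have [in1 out1] := eager t.-1; case: (ltnP t.-1 t1) => [/in1[a csa] _|/out1/negPf-> //].
  have hE c : wf B c -> (exists l, c s0 = l ++ 1%N :: p) -> height c 1 = (size p).+1.
    by move=> cwf [l e]; rewrite (height_split cwf e).
  rewrite (hE c0) //; last by exists (rcons a0 jb); rewrite cs0 cat_rcons.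
  apply: hE; first exact: (mid_wf c0wf szT sol).
  rewrite /mid; have := turn_legal_reloc szT sol tT.
  case: (nth _ _ _).1 => [[s d]|]; last by exists (rcons a jb); rewrite /= csa cat_rcons.
  move=> /andP[leg _]; have [b [stk [cs sd _]]] := legal_relocP leg.
  rewrite -[exec _ _]/(next _ (Reloc s d)) (relocE d cs) ffunE; case: eqP => [es|_].
    case: a csa => [|x a] csa; move: cs; rewrite -es csa => -[_ <-]; first by exists [::].
    by exists (rcons a jb); rewrite cat_rcons.
  case: eqP => [<-|_]; rewrite csa; last by exists (rcons a jb); rewrite cat_rcons.
  by exists (b :: rcons a jb); rewrite /= cat_rcons.
pose v := encoding R B c0 trs.
have v_m3 : brp_m3 B H L T c0 v.
  exact: enc_m3 c0wf c0pres c0_valid.2 B_gt0 L_gt0 L_lower T_upper szT sol reloc floor mid1.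
have v_obj : objective B T v = m%:R.
  exact: enc_objective c0wf c0pres c0_valid.2 B_gt0 L_gt0 L_lower T_upper szT sol reloc floor mid1.
have stwf t : wf B (stage c0 trs t) by apply: stage_wf sol _.
have v_simpl : brp_m3_simplified B H L T c0 v.
  (* Before stage [t1] block 1 has its initial neighbours [jb] and [below B p]; from [t1] on it is
     absent. *)
  apply: (m3_simplified c0wf B_gt0 c0_blocked v_m3 (remains := fun t => t < t1)%N) => //.
  - move=> j t tT /=; have [in1 out1] := eager t; case: ltnP => [/in1[a csa]|/out1 ab] /=.
      rewrite -cat_rcons in csa; rewrite (lies_on_mem j (stwf t) csa).
      by rewrite -cat_rcons in cs0; rewrite (lies_on_mem j c0wf cs0).
    by case: (boolP (lies_on _ _ _ _)) => // /lies_on_present; rewrite (negPf ab).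
  - move=> j t tT /=; have [in1 out1] := eager t; case: ltnP => [/in1[a csa]|/out1 ab] /=.
      by rewrite (lies_on_mem_above j (stwf t) csa) (lies_on_mem_above j c0wf cs0).
    by case: (boolP (lies_on _ _ _ _)) => // /lies_on_presentr/(_ B_gt0); rewrite (negPf ab).
(* Integral x and u satisfy the relaxed bounds, so one decoding serves both models. *)
have m3_lower (w : solution R) : brp_m3 B H L T c0 w -> m%:R <= objective B T w.
  move=> [com x5 _ _ _ u2]; have [||ms [solw <- _]] := decoding c0wf c0pres L_gt0 com.
  - by move=> i j t iB jB ji tT; case: (x5 i j t iB jB ji tT) => ->; rewrite ?lexx ler01.
  - by move=> i t iB tT; have [k [/andP[k1 kH] ->]] := u2 i t iB tT; rewrite ler1n k1 ler_nat.
  - by rewrite ler_nat; apply: m_min.2.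
have decode (w : solution R) : brp_m3_simplified B H L T c0 w -> exists ms,
    [/\ solves H c0 ms, (nreloc ms)%:R = objective B T w & encodes B T c0 w ms].
  by case=> com x5 u2 *; apply: (decoding c0wf c0pres L_gt0 com).
have simpl_lower (w : solution R) : brp_m3_simplified B H L T c0 w -> m%:R <= objective B T w.
  by move=> /decode[ms [solw <- _]]; rewrite ler_nat; apply: m_min.2.
split.
- by exists v; split=> //; split=> // w /m3_lower; rewrite v_obj.
- by exists v; split=> //; split=> // w /simpl_lower; rewrite v_obj.
move=> w [w_simpl w_min]; have [ms [solw objw encw]] := decode w w_simpl.
(* Comparison with the feasible [v] of value [m] pins the optimal value of [w]. *)
exists ms; split=> //; apply/eqP; rewrite -(eqr_nat R) objw eq_le simpl_lower // andbT -v_obj.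
exact: w_min.
Qed.
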